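(* Let $G$ be a group acting on a paraclique graph $X$ and let $\mathscr{C}=\{(C,\delta_C)\mid C\subset X \text{ clique}\}$ be a coherent and $G$-invariant system of metrics, with extended metric $\delta$. If $g\in G$ admits an axis in $X$ and skewers a pair of hyperplanes that are well-separated relative to $\mathscr{C}$, then $g$ is contracting in $(X,\delta)$.
   Context: Graphs are identified with their vertex sets and carry the path metric $d$. A clique is a maximal complete subgraph. A subgraph $Y\subset X$ is gated if for every $x\in X$ there is $\mathrm{proj}_Y(x)\in Y$ such that every $y\in Y$ is joined to $x$ by a geodesic through $\mathrm{proj}_Y(x)$. A connected graph is clique-gated if its cliques are gated; then for cliques $C_1,C_2$, either $\mathrm{proj}_{C_2}(C_1)$ is a single vertex or $\mathrm{proj}_{C_2}:C_1\to C_2$ is a bijection; in the latter case $C_1,C_2$ are parallel. A paraclique graph is a clique-gated graph in which parallelism is transitive. A hyperplane is the union of all the edges of the cliques in a parallelism class. The sectors delimited by a hyperplane $J$ are the connected components of the graph $X\backslash\backslash J$ obtained from $X$ by removing the edges of $J$. Two hyperplanes are transverse if every sector of one intersects every sector of the other. A hyperplane separates two hyperplanes (or vertices) if these lie in two distinct sectors that it delimits. A system of metrics is a choice of a metric $\delta_C$ on each clique $C$. Its extended (pseudo-)metric is $\delta(x,y)=\inf\sum_{i=0}^{n-1}\delta_{C_i}(v_i,v_{i+1})$, over all vertices $v_0=x,\ldots,v_n=y$ and cliques $C_0,\ldots,C_{n-1}$ with $v_i,v_{i+1}\in C_i$. The system is coherent if for parallel cliques $C_1,C_2$ the projection $(C_1,\delta_{C_1})\to(C_2,\delta_{C_2})$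 is an isometry; it is $G$-invariant if $\delta_{gC}(gx,gy)=\delta_C(x,y)$ for all $g\in G$, cliques $C$, $x,y\in C$. The thickness $\mathrm{thick}(J)$ of a hyperplane $J$ is $\mathrm{diam}(C,\delta_C)$ for any clique $C\subset J$. A facing triple is a triple of pairwise non-transverse hyperplanes none of which separates the other two. Two hyperplanes $H,K$ are well-separated relative to $\mathscr{C}$ if there is $L\geq 0$ such that $\sum_{i=1}^n\mathrm{thick}(J_i)\leq L$ for every collection $\{J_1,\ldots,J_n\}$ of hyperplanes transverse to both $H$ and $K$ containing no facing triple. An isometry $g$ skewers a pair of hyperplanes $J_1,J_2$ if they delimit two sectors $S_1\supsetneq S_2$ (with $S_i$ delimited by $J_i$) such that $g^nS_1\subsetneq S_2$ for some $n\in\mathbb{Z}$. An axis of $g$ is a bi-infinite geodesic (for $d$) on which $g$ acts as a non-trivial translation. The element $g$ is contracting in $(X,\delta)$ if, for some (equivalently any) $o\in X$, the orbit map $n\mapsto g^no$ is a quasi-isometric embedding $\mathbb{Z}\to (X,\delta)$ and there is $D\geq 0$ such that for every $\delta$-ball $B$ disjoint from $\langle g\rangle\cdot o$ the nearest-point projection of $B$ on $\langle g\rangle\cdot o$ has diameter $\leq D$. *)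

(* Defs.v *)
From HB Require Import structures.
From mathcomp Require Import all_boot all_order all_algebra.
From mathcomp Require Import boolp classical_sets functions reals constructive_ereal.
From mathcomp Require Import ereal.

Set Implicit Arguments.
Unset Strict Implicit.
Unset Printing Implicit Defensive.

Import Order.TTheory GRing.Theory Num.Theory.
Local Open Scope classical_set_scope.
Local Open Scope ring_scope.

Record graph := Graph {
  vertex :> Type;
  adj : rel vertex;
  adj_sym : symmetric adj;
  adj_irr : irreflexive adj }.

HB.instance Definition _ (X : graph) := gen_eqMixin (vertex X).
HB.instance Definition _ (X : graph) := gen_choiceMixin (vertex X).

Section Graph.
Variable X : graph.
Implicit Types (x y z : X) (Y C S T : set X) (J H K : set (X * X)).

Definition has_walk (e : rel X) x y (n : nat) : Prop :=
  exists p : seq X, [/\ path e x p, last x p = y & size p = n].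

Definition joined (e : rel X) x y : Prop := exists n, has_walk e x y n.

Definition connected_graph : Prop := forall x y, joined (@adj X) x y.

(* The least length of a path; the value 0 is a dummy if there is no path. *)
Definition dist x y : nat :=
  xget 0%N [set n | has_walk (@adj X) x y n /\
                    forall m, has_walk (@adj X) x y m -> (n <= m)%N].

Definition geodesic (gam : nat -> X) x y (n : nat) : Prop :=
  [/\ gam 0%N = x, gam n = y
    & forall i j : nat, (i <= j <= n)%N -> dist (gam i) (gam j) = (j - i)%N].

Definition gate Y x : set X :=
  [set p | Y p /\ forall y, Y y ->
     exists (gam : nat -> X) (n i : nat),
       [/\ geodesic gam x y n, (i <= n)%N & gam i = p]].

Definition gated Y : Prop := forall x, exists p, gate Y x p.

(* If Y is gated, the gate of x is unique and [gate_proj Y x] is that gate. *)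
Definition gate_proj Y x : X := xget x (gate Y x).

Definition complete_subgraph Y : Prop :=
  forall x y, Y x -> Y y -> x <> y -> adj x y.

Definition clique C : Prop :=
  complete_subgraph C /\ forall Y, complete_subgraph Y -> C `<=` Y -> Y = C.

Definition clique_gated : Prop :=
  connected_graph /\ forall C, clique C -> gated C.

Definition parallel C1 C2 : Prop := set_bij C1 C2 (gate_proj C2).

Definition paraclique : Prop :=
  clique_gated /\
  forall C1 C2 C3, clique C1 -> clique C2 -> clique C3 ->
    parallel C1 C2 -> parallel C2 C3 -> parallel C1 C3.

(* Sets of edges are symmetric sets of pairs of adjacent vertices. *)
Definition edges C : set (X * X) :=
  [set xy | [/\ C xy.1, C xy.2 & adj xy.1 xy.2]].

Definition hyperplane J : Prop :=
  exists2 C, clique C &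
    J = [set xy | exists C', [/\ clique C', parallel C C' & edges C' xy]].

Definition cut J : rel X := [rel x y | adj x y && ((x, y) \notin J)].

Definition sector J S : Prop := exists x, S = [set y | joined (cut J) x y].

Definition transverse H K : Prop :=
  forall S T, sector H S -> sector K T -> S `&` T !=set0.

Definition lies_in H S : Prop := forall x y, H (x, y) -> S x /\ S y.

Definition separates J H K : Prop :=
  exists S T, [/\ sector J S, sector J T, S <> T, lies_in H S & lies_in K T].

Definition facing_triple J H K : Prop :=
  [/\ J <> H, J <> K & H <> K] /\
  [/\ ~ transverse J H, ~ transverse J K & ~ transverse H K] /\
  [/\ ~ separates J H K, ~ separates H J K & ~ separates K J H].

End Graph.

Section Metrics.
Variables (X : graph) (R : realType).
Implicit Types (delta : set X -> X -> X -> R) (C : set X) (H J K : set (X * X)).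

(* Only the values of [delta C] on C, for cliques C, are relevant. *)
Definition metric_system delta : Prop :=
  forall C, clique C ->
    [/\ forall x y, C x -> C y -> 0 <= delta C x y,
        forall x y, C x -> C y -> (delta C x y = 0 <-> x = y),
        forall x y, C x -> C y -> delta C x y = delta C y x
      & forall x y z, C x -> C y -> C z ->
          delta C x z <= delta C x y + delta C y z].

Definition coherent delta : Prop :=
  forall C1 C2, clique C1 -> clique C2 -> parallel C1 C2 ->
    forall x y, C1 x -> C1 y ->
      delta C2 (gate_proj C2 x) (gate_proj C2 y) = delta C1 x y.

Definition ext_metric delta (x y : X) : R :=
  inf [set s | exists (n : nat) (v : nat -> X) (C : nat -> set X),
    [/\ v 0%N = x, v n = y,
        forall i, (i < n)%N -> [/\ clique (C i), C i (v i) & C i (v i.+1)]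
      & s = \sum_(i < n) delta (C i) (v i) (v i.+1)]].

Definition clique_diam delta C : \bar R :=
  ereal_sup [set r | exists x y, [/\ C x, C y & r = (delta C x y)%:E]].

(* For a coherent system, the diameter is the same for all cliques in J. *)
Definition thick delta J : \bar R :=
  clique_diam delta (xget set0 [set C | clique C /\ edges C `<=` J]).

Definition well_separated delta H K : Prop :=
  exists2 L : R, 0 <= L &
    forall (n : nat) (J : 'I_n -> set (X * X)),
      injective J ->
      (forall i, [/\ hyperplane (J i), transverse (J i) H
                   & transverse (J i) K]) ->
      (forall i j k, ~ facing_triple (J i) (J j) (J k)) ->
      (\sum_(i < n) thick delta (J i) <= L%:E)%E.

End Metrics.

Definition zexpg (G : groupType) (g : G) (n : int) : G :=
  match n with
  | Posz k => (g ^+ k)%g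
  | Negz k => (g ^- k.+1)%g
  end.

Record graph_action (G : groupType) (X : graph) := GraphAction {
  act :> G -> X -> X;
  act1 : forall x, act 1%g x = x;
  actM : forall (g h : G) x, act (g * h)%g x = act g (act h x);
  act_adj : forall (g : G) x y, adj (act g x) (act g y) = adj x y }.

Section Action.
Variables (G : groupType) (X : graph) (a : graph_action G X).

Definition invariant_system (R : realType) (delta : set X -> X -> X -> R) : Prop :=
  forall (g : G) C, clique C -> forall x y, C x -> C y ->
    delta (a g @` C) (a g x) (a g y) = delta C x y.

Definition admits_axis (g : G) : Prop :=
  exists gam : int -> X,
    (forall i j : int, (dist (gam i) (gam j))%:Z = `|i - j|) /\
    exists2 t : int, t != 0 & forall i, a g (gam i) = gam (i + t).

Definition skewers (g : G) (J1 J2 : set (X * X)) : Prop :=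
  exists S1 S2 : set X,
    [/\ sector J1 S1, sector J2 S2, S2 `<` S1
      & exists n : int, a (zexpg g n) @` S1 `<` S2].

Definition orbit_map (g : G) (o : X) (n : int) : X := a (zexpg g n) o.

End Action.

Section Contracting.
Variables (X : graph) (R : realType) (d : X -> X -> R).

Definition qi_embedding (f : int -> X) : Prop :=
  exists A B : R, [/\ 1 <= A, 0 <= B &
    forall m n : int,
      A^-1 * `|m - n|%:~R - B <= d (f m) (f n) <= A * `|m - n|%:~R + B].

Definition open_ball (p : X) (r : R) : set X := [set x | d p x < r].

Definition nearest (Y : set X) (x : X) : set X :=
  [set z | Y z /\ forall y, Y y -> d x z <= d x y].

Definition contracting (G : groupType) (a : graph_action G X) (g : G) : Prop :=
  exists o : X,
    qi_embedding (orbit_map a g o) /\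
    exists2 D : R, 0 <= D &
      forall (p : X) (r : R),
        open_ball p r `&` range (orbit_map a g o) = set0 ->
        forall x y z w : X,
          open_ball p r x -> open_ball p r y ->
          nearest (range (orbit_map a g o)) x z ->
          nearest (range (orbit_map a g o)) y w ->
          d z w <= D.

End Contracting.

(* Main.v *)
(**
The sectors of a hyperplane are the fibres of the gate projection to any of its
cliques, so two vertices are separated by the hyperplane of C exactly when their
projections to C differ, and delta(x, y) is the sum of the contributions
delta_C(proj_C x, proj_C y) of the hyperplanes separating x and y. Let h = g^n
with h S1 < S2 < S1; the translates of S1 by the powers of h assign to every
vertex an integer level. Let o be an orbit point on the axis whose level lies
strictly between those of x and y, with some margin. A hyperplane contributing to
the defect delta(x, o) + delta(o, y) - delta(x, y) separates o from x and from y,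
and it misses one half of the axis, so it is transverse to a translate of the
pair J1, J2 on that side. As all these hyperplanes separate o from a single
vertex, they contain no facing triple, and well-separation bounds the defect
uniformly. This forces the nearest-point projection of x to the orbit to have
almost the level of x, and two points of a ball disjoint from the orbit to have
almost the same level or to be close to the orbit.
*)

Require Import Defs.
From mathcomp Require Import all_boot all_order all_algebra.
From mathcomp Require Import boolp classical_sets functions reals constructive_ereal.
From mathcomp Require Import ereal.
From mathcomp Require Import zify ring lra.

Set Implicit Arguments.
Unset Strict Implicit.
Unset Printing Implicit Defensive.

Import Order.TTheory GRing.Theory Num.Theory.

(** * Path metric and cliques *)

Section GraphDistance.
Local Open Scope classical_set_scope.
Variable X : graph.
Hypothesis conX : connected_graph X.
Implicit Types (x y z : X) (C : set X).

Lemma dist_spec x y : has_walk (@adj X) x y (dist x y) /\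
  forall m, has_walk (@adj X) x y m -> (dist x y <= m)%N.
Proof.
have [n wn] := conX x y.
pose P n := `[< has_walk (@adj X) x y n >].
have exP : exists n, P n by exists n; apply/asboolP.
rewrite /dist; case: xgetP => [k _ //|none]; exfalso.
apply: (none (ex_minn exP)).
by case: ex_minnP => k /asboolP wk mink; split=> // m /asboolP/mink.
Qed.

Lemma dist_triangle x y z : (dist x z <= dist x y + dist y z)%N.
Proof.
have [[p [pp lp <-]] _] := dist_spec x y.
have [[q [pq lq <-]] _] := dist_spec y z.
apply: (dist_spec x z).2; exists (p ++ q).
by rewrite cat_path pp last_cat lp size_cat.
Qed.

Lemma distxx x : dist x x = 0%N.
Proof. by apply/eqP; rewrite -leqn0; apply: (dist_spec x x).2; exists [::]. Qed.

Lemma dist_eq0 x y : dist x y = 0%N -> x = y.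
Proof. by move=> d0; have [[p [_ lp +]] _] := dist_spec x y; rewrite d0; case: p lp. Qed.

Lemma dist_sym_le x y : (dist y x <= dist x y)%N.
Proof.
have [[p [pp lp <-]] _] := dist_spec x y.
apply: (dist_spec y x).2; exists (rev (belast x p)).
rewrite -lp rev_path size_rev size_belast; split=> //.
  by rewrite (eq_path (e' := @adj X)) // => u v; exact: adj_sym.
by case: p {pp lp} => //= u p; rewrite rev_cons last_rcons.
Qed.

Lemma dist_sym x y : dist x y = dist y x.
Proof. by apply/eqP; rewrite eqn_leq !dist_sym_le. Qed.

Lemma adj_neq x y : adj x y -> x <> y.
Proof. by move=> xy exy; rewrite exy adj_irr in xy. Qed.

Lemma dist_adj x y : adj x y -> dist x y = 1%N.
Proof.
move=> xy; have : (dist x y <= 1)%N.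
  by apply: (dist_spec x y).2; exists [:: y]; rewrite /= xy.
by case E: (dist x y) => [|[|n]] // _; case: (adj_neq xy (dist_eq0 E)).
Qed.

Lemma dist_step x y n : dist x y = n.+1 ->
  exists z, adj x z /\ dist z y = n.
Proof.
move=> dn; have [[[|z p] [/= pp lp sp]] _] := dist_spec x y.
  by rewrite -sp in dn.
rewrite dn in sp; case: sp => sp.
have /andP[xz {}pp] := pp.
exists z; split=> //; apply/eqP; rewrite eqn_leq; apply/andP; split.
  by apply: (dist_spec z y).2; exists p.
by rewrite -ltnS -dn -(add1n (dist z y)) -(dist_adj xz) dist_triangle.
Qed.

(** Zorn's lemma. The endpoints are adjoined inside the predicate rather than required in [A], so
    that the empty chain needs no separate treatment. *)
Lemma edge_clique x y : adj x y -> exists C, [/\ clique C, C x & C y].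
Proof.
move=> xy.
pose P : set (set X) := [set A | complete_subgraph (A `|` [set x; y])].
have [A [PA maxA]] : exists A, P A /\ forall B, A `<` B -> ~ P B.
  apply: Zorn_bigcup => F FP totF u v.
  have base w : (w = x \/ w = y) -> forall A, (A `|` [set x; y]) w by move=> ? ?; right.
  have key A u' v' : F A -> (A `|` [set x; y]) u' -> (A `|` [set x; y]) v' -> u' <> v' -> adj u' v'.
    by move=> /FP; apply.
  case=> [[A FA Au]|ub]; case=> [[B FB Bv]|vb].
  - have [AB|BA] := totF _ _ FA FB.
      by apply: (key B) => //; left => //; exact: AB.
    by apply: (key A) => //; left => //; exact: BA.
  - by apply: (key A) => //; [left|right].
  - by apply: (key B) => //; [right|left].
  - case: ub vb => -> [] -> // _; by rewrite ?xy // adj_sym xy.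
exists (A `|` [set x; y]); split; [|by right; left|by right; right].
split=> // Y cY sY; rewrite eqEsubset; split=> // z Yz.
apply: contrapT => nz; apply: (maxA Y).
  split; first by move=> w Aw; apply: sY; left.
  by move=> YA; apply: nz; left; apply: YA.
rewrite /P /= (_ : Y `|` _ = Y) //; apply/setUidPl => w ew.
by apply: sY; right.
Qed.

End GraphDistance.

(** * Projections to cliques *)

(** By [joinedE] this is separation of [x] and [y] by the hyperplane of [C]; the form by projections
    avoids paths. *)
Definition sep (X : graph) (C : set X) (x y : X) : Prop :=
  gate_proj C x <> gate_proj C y.

Definition hyp_of (X : graph) (C : set X) : set (X * X) :=
  [set xy | exists C', [/\ clique C', parallel C C' & edges C' xy]]%classic.

Section CliqueGated.
Local Open Scope classical_set_scope.
Variable X : graph.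
Hypothesis cgX : clique_gated X.
Hypothesis ntX : exists x y : X, x <> y.
Implicit Types (x y z c : X) (C D : set X).
Let conX : connected_graph X := cgX.1.

Lemma proj_gate C x : clique C -> gate C x (gate_proj C x).
Proof. by move=> cC; apply: xgetPex; exact: cgX.2. Qed.

Lemma proj_in C x : clique C -> C (gate_proj C x).
Proof. by move=> /(proj_gate x)[]. Qed.

Lemma proj_dist C x c : clique C -> C c ->
  dist x c = (dist x (gate_proj C x) + dist (gate_proj C x) c)%N.
Proof.
move=> /(proj_gate x)[_ gateC] /gateC[gam [n [i [[g0 gn geo] lein gi]]]].
rewrite -gi -g0 -gn !geo ?leq0n ?leqnn ?lein //=.
by rewrite !subn0 subnKC.
Qed.

Lemma clique_adj C x y : clique C -> C x -> C y -> x <> y -> adj x y.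
Proof. by case=> cC _; exact: cC. Qed.

Lemma clique_dist C x y : clique C -> C x -> C y -> x <> y -> dist x y = 1%N.
Proof. by move=> cC Cx Cy nxy; apply/(dist_adj conX)/(clique_adj cC). Qed.

Lemma proj_uniq C x p : clique C -> C p ->
  (forall c, C c -> dist x c = dist x p + dist p c)%N -> gate_proj C x = p.
Proof.
move=> cC Cp /(_ _ (proj_in x cC)); rewrite (proj_dist x cC Cp) => dE.
by apply/(dist_eq0 conX); lia.
Qed.

Lemma proj_id C x : clique C -> C x -> gate_proj C x = x.
Proof. by move=> cC Cx; apply: proj_uniq => // c _; rewrite (distxx conX). Qed.

Lemma proj_nearest C x c : clique C -> C c -> c <> gate_proj C x ->
  dist x c = (dist x (gate_proj C x)).+1.
Proof.
move=> cC Cc nc; rewrite (proj_dist x cC Cc) (clique_dist cC _ Cc) ?addn1 //.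
  exact: proj_in.
by move=> e; apply: nc.
Qed.

(** A vertex of one clique outside the other would be adjacent to both [x] and [y], but only its
    gate can be adjacent to it. *)
Lemma clique_uniq C D x y : clique C -> clique D -> x <> y ->
  C x -> C y -> D x -> D y -> C = D.
Proof.
have sub A B : clique A -> clique B -> x <> y ->
    A x -> A y -> B x -> B y -> B `<=` A.
  move=> cA cB nxy Ax Ay Bx By z Bz; apply: contrapT => nAz.
  have h c : A c -> B c -> c = gate_proj A z.
    move=> Ac Bc; apply: contrapT => nc.
    have := proj_nearest cA Ac nc; rewrite (clique_dist cB Bz Bc); last first.
      by move=> e; apply: nAz; rewrite e.
    by case=> /esym/(dist_eq0 conX) e; apply: nAz; rewrite e; exact: proj_in.
  by apply: nxy; rewrite (h x) // (h y).
by move=> *; rewrite eqEsubset; split; apply: sub.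
Qed.

Lemma vertex_nbr x : exists y, adj x y.
Proof.
have [y nxy] : exists y, x <> y.
  have [u [v nuv]] := ntX; have [e|] := pselect (x = u); last by exists u.
  by exists v; rewrite e.
case E: (dist x y) => [|n]; first by case: nxy; exact: (dist_eq0 conX).
by have [z [xz _]] := dist_step conX E; exists z.
Qed.

Lemma clique_nbr C x : clique C -> C x -> exists2 y, C y & x <> y.
Proof.
move=> cC Cx; apply: contrapT => none.
have CE c : C c -> c = x.
  by move=> Cc; apply: contrapT => nc; apply: none; exists c => // e; apply: nc.
have [y xy] := vertex_nbr x.
have [D [cD Dx Dy]] := edge_clique xy.
apply: none; exists y; last exact: adj_neq.
have <- : D = C; last by [].
by apply: cC.2; [exact: cD.1 | move=> c /CE ->].
Qed.

Lemma clique_pair C : clique C -> exists x y, [/\ C x, C y & x <> y].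
Proof.
move=> cC; have [x _] := ntX; have Cp := proj_in x cC.
by have [y Cy ny] := clique_nbr cC Cp; exists (gate_proj C x), y.
Qed.

(** Each of [x], [y] is one step farther from the gate of the other than from its own, so the
    triangle inequality along the edge forces equal distances. Hence [x] is strictly closer than [y]
    to the gate of [x], which leaves only [x] as gate on the way back. *)
Lemma sep_proj_dist C D x y : clique C -> clique D -> C x -> C y -> sep D x y ->
  dist x (gate_proj D x) = dist y (gate_proj D y) /\
  gate_proj C (gate_proj D x) = x.
Proof.
move=> cC cD Cx Cy sxy.
have nxy : x <> y by move=> e; apply: sxy; rewrite e.
have dxy := clique_dist cC Cx Cy nxy.
have dx := @proj_nearest D x _ cD (proj_in y cD) (not_eq_sym sxy).
have dy := @proj_nearest D y _ cD (proj_in x cD) sxy.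
have t1 := dist_triangle conX x y (gate_proj D y).
have t2 := dist_triangle conX y x (gate_proj D x).
rewrite (dist_sym conX y x) in t2.
have e : dist x (gate_proj D x) = dist y (gate_proj D y) by lia.
split=> //; apply: contrapT => np.
have px := @proj_nearest C (gate_proj D x) _ cC Cx (not_eq_sym np).
have [py|npy] := pselect (y = gate_proj C (gate_proj D x)).
  by rewrite -py !(dist_sym conX (gate_proj D x)) in px; lia.
have := @proj_nearest C (gate_proj D x) _ cC Cy npy.
by rewrite !(dist_sym conX (gate_proj D x)) in px *; lia.
Qed.

Lemma sep_cancel C D x y : clique C -> clique D -> C x -> C y -> sep D x y ->
  forall z, C z -> gate_proj C (gate_proj D z) = z.
Proof.
move=> cC cD Cx Cy sxy z Cz.
have [zx|zx] := pselect (gate_proj D z = gate_proj D x).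
  by apply: (sep_proj_dist cC cD Cz Cy _).2; rewrite /sep zx.
exact: (sep_proj_dist cC cD Cz Cx zx).2.
Qed.

Lemma sep_proj_inj C D x y : clique C -> clique D -> C x -> C y -> sep D x y ->
  forall u v, C u -> C v -> gate_proj D u = gate_proj D v -> u = v.
Proof.
move=> cC cD Cx Cy sxy u v Cu Cv e.
by rewrite -(sep_cancel cC cD Cx Cy sxy Cu) e (sep_cancel cC cD Cx Cy sxy Cv).
Qed.

Lemma sep_sep C D x y : clique C -> clique D -> C x -> C y -> sep D x y ->
  sep C (gate_proj D x) (gate_proj D y).
Proof.
move=> cC cD Cx Cy sxy; rewrite /sep !(sep_cancel cC cD Cx Cy sxy) //.
by move=> e; apply: sxy; rewrite e.
Qed.

(** One separated pair makes the two projections mutually inverse: a projection between cliques is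
    either constant or bijective. *)
Lemma sep_parallel C D x y : clique C -> clique D -> C x -> C y -> sep D x y ->
  parallel C D.
Proof.
move=> cC cD Cx Cy sxy; split.
- by move=> z _; exact: proj_in.
- by move=> u v /set_mem Cu /set_mem Cv; exact: (sep_proj_inj cC cD Cx Cy sxy).
- move=> w Dw; exists (gate_proj C w); first exact: proj_in.
  exact: (sep_cancel cD cC (proj_in x cD) (proj_in y cD) (sep_sep cC cD Cx Cy sxy)).
Qed.

Lemma parallel_sep C D x y : clique C -> parallel C D -> C x -> C y -> x <> y ->
  sep D x y.
Proof. by move=> cC [_ inj _] Cx Cy nxy e; apply: nxy; apply: inj; rewrite ?in_setE. Qed.

Lemma parallelC C D : clique C -> clique D -> parallel C D -> parallel D C.
Proof.
move=> cC cD pCD; have [x [y [Cx Cy nxy]]] := clique_pair cC.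
have sxy := parallel_sep cC pCD Cx Cy nxy.
exact: (sep_parallel cD cC (proj_in x cD) (proj_in y cD) (sep_sep cC cD Cx Cy sxy)).
Qed.

Lemma parallel_cancel C D z : clique C -> clique D -> parallel C D -> C z ->
  gate_proj C (gate_proj D z) = z.
Proof.
move=> cC cD pCD; have [x [y [Cx Cy nxy]]] := clique_pair cC.
exact: (sep_cancel cC cD Cx Cy (parallel_sep cC pCD Cx Cy nxy)).
Qed.

Lemma parallel_refl C : clique C -> parallel C C.
Proof.
move=> cC; have [x [y [Cx Cy nxy]]] := clique_pair cC.
by apply: (sep_parallel cC cC Cx Cy); rewrite /sep !proj_id.
Qed.

Lemma nonparallel_proj C D x y : clique C -> clique D -> ~ parallel C D ->
  C x -> C y -> gate_proj D x = gate_proj D y.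
Proof.
by move=> cC cD nCD Cx Cy; apply: contrapT => sxy; apply/nCD/(sep_parallel cC cD Cx Cy).
Qed.

(* A geodesic from x to its gate stays in the fibre of the projection; hence
   the fibres are connected. *)
Lemma fibre_const (T : Type) (f : X -> T) C : clique C ->
  (forall u v, adj u v -> gate_proj C u = gate_proj C v -> f u = f v) ->
  forall x y, gate_proj C x = gate_proj C y -> f x = f y.
Proof.
move=> cC fE; suff fp x : f x = f (gate_proj C x).
  by move=> x y e; rewrite fp e -fp.
move E: (dist x (gate_proj C x)) => n; elim: n x E => [|n IHn] x E.
  by rewrite -(dist_eq0 conX E).
have [z [xz dz]] := dist_step conX E.
have pz : gate_proj C z = gate_proj C x.
  apply: proj_uniq => // [|c Cc]; first exact: proj_in.
  apply/eqP; rewrite eqn_leq (dist_triangle conX) /=.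
  have := dist_triangle conX x z c.
  by rewrite (proj_dist x cC Cc) (dist_adj conX xz) E; lia.
by rewrite (fE x z) // (IHn z) pz.
Qed.

(** The distances from [w] to [C] take at most two values, the smaller one only at the gate. *)
Lemma proj_edge C x y w : clique C -> C x -> C y ->
  dist x w = (dist y w).+1 -> gate_proj C w = y.
Proof.
move=> cC Cx Cy dxw; apply: contrapT => ny.
have := proj_nearest cC Cy (not_eq_sym ny).
have := proj_dist w cC Cx; rewrite -!(dist_sym conX w) in dxw *.
have [xe|nx] := pselect (x = gate_proj C w).
  by rewrite -xe (distxx conX); lia.
by have := proj_nearest cC Cx nx; lia.
Qed.

End CliqueGated.

(** * Sectors, separation and transversality *)

Section Paraclique.
Local Open Scope classical_set_scope.
Variable X : graph.
Hypothesis pX : paraclique X.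
Hypothesis ntX : exists x y : X, x <> y.
Implicit Types (x y z c u v o q : X) (C D E : set X).
Let cgX : clique_gated X := pX.1.
Let conX : connected_graph X := cgX.1.

Lemma parallel_trans C D E : clique C -> clique D -> clique E ->
  parallel C D -> parallel D E -> parallel C E.
Proof. exact: pX.2. Qed.

(** By [fibre_const] it suffices to look at edges. The clique of an edge separated by one of [C],
    [D] is parallel to it, hence to the other by transitivity of parallelism. *)
Lemma sep_par C D x y : clique C -> clique D -> parallel C D ->
  sep C x y <-> sep D x y.
Proof.
have imp A B : clique A -> clique B -> parallel A B ->
    gate_proj A x = gate_proj A y -> gate_proj B x = gate_proj B y.
  move=> cA cB pAB; apply: (fibre_const cgX cA) => u v uv e.
  have [F [cF Fu Fv]] := edge_clique uv.
  apply: contrapT => /(sep_parallel cgX cF cB Fu Fv) pFB.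
  have pFA : parallel F A.
    by apply: (parallel_trans cF cB cA) => //; exact: (parallelC cgX ntX).
  exact: (parallel_sep cF pFA Fu Fv (adj_neq uv) e).
move=> cC cD pCD; split; apply: contra_not; apply: imp => //.
exact: (parallelC cgX ntX).
Qed.

Lemma cut_adj C u v : clique C ->
  cut (hyp_of C) u v = adj u v && `[< gate_proj C u = gate_proj C v >].
Proof.
move=> cC; rewrite /cut /=; case uv: (adj u v) => //=.
have [E [cE Eu Ev]] := edge_clique uv.
apply/idP/idP.
  rewrite notin_setE => nuv; apply/asboolP; apply: contrapT => suv; apply: nuv.
  exists E; split=> //; apply: (parallelC cgX ntX) => //.
  exact: (sep_parallel cgX cE cC Eu Ev).
move=> /asboolP e; rewrite notin_setE => -[F [cF pCF [/= Fu Fv _]]].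
apply: (parallel_sep cF (parallelC cgX ntX cC cF pCF) Fu Fv) => //.
exact: adj_neq.
Qed.

Lemma joinedE C x y : clique C ->
  joined (cut (hyp_of C)) x y <-> gate_proj C x = gate_proj C y.
Proof.
move=> cC; split.
  move=> [n [p [pp <- _]]]; elim: p x pp => //= z p IHp x /andP[].
  by rewrite cut_adj // => /andP[_ /asboolP ->] /IHp.
have jxx u : joined (cut (hyp_of C)) u u by exists 0%N, [::].
have jadj u v w : cut (hyp_of C) u v -> joined (cut (hyp_of C)) v w ->
    joined (cut (hyp_of C)) u w.
  by move=> uv [n [p [pp lp sp]]]; exists n.+1, (v :: p); rewrite /= uv pp sp.
(* [fibre_const] is applied to the map sending a vertex to its component after the cut. *)
move=> e; suff -> : joined (cut (hyp_of C)) x = joined (cut (hyp_of C)) y by [].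
move: x y e; apply: (fibre_const cgX cC) => u v uv e.
rewrite predeqE => w; split; apply: jadj; rewrite cut_adj //.
  by rewrite adj_sym uv /=; apply/asboolP.
by rewrite uv /=; apply/asboolP.
Qed.

Lemma sectorE C S : clique C -> sector (hyp_of C) S <->
  exists2 c, C c & S = [set y | gate_proj C y = c].
Proof.
move=> cC; split=> [[x ->]|[c Cc ->]].
  exists (gate_proj C x); first exact: proj_in.
  by rewrite predeqE => y /=; rewrite joinedE //; split=> ->.
exists c; rewrite predeqE => y /=; rewrite joinedE // (proj_id cgX cC Cc).
by split=> ->.
Qed.

Lemma hyp_of_par C D : clique C -> clique D -> parallel C D -> hyp_of C = hyp_of D.
Proof.
move=> cC cD pCD; rewrite predeqE => xy; split=> -[E [cE pE eE]]; exists E; split=> //.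
  by apply: (parallel_trans cD cC cE) => //; exact: (parallelC cgX ntX).
exact: (parallel_trans cC cD cE).
Qed.

Lemma hyp_of_inj C D : clique C -> clique D -> hyp_of C = hyp_of D -> parallel C D.
Proof.
move=> cC cD eCD; have [x [y [Cx Cy nxy]]] := clique_pair cgX ntX cC.
have : hyp_of C (x, y).
  exists C; split=> //; first exact: (parallel_refl cgX ntX).
  by split=> //=; exact: (clique_adj cC).
rewrite eCD => -[E [cE pDE [/= Ex Ey _]]].
rewrite (clique_uniq cgX cC cE nxy) //; exact: (parallelC cgX ntX).
Qed.

(** The pair [u], [v] is the first edge, along a geodesic from [x] to [y], whose ends project
    differently to [D]. *)
Lemma sep_geodesic D x y : clique D -> sep D x y -> exists C u v,
  [/\ clique C, parallel C D, C u, C v & u <> v] /\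
  dist x y = (dist x u + dist u y)%N /\ dist u y = (dist v y).+1.
Proof.
move=> cD; move E: (dist x y) => n; elim: n x E => [|n IHn] x E sxy.
  by case: sxy; rewrite (dist_eq0 conX E).
have [z [xz dz]] := dist_step conX E.
have [pxz|sxz] := pselect (gate_proj D x = gate_proj D z).
  have szy : sep D z y by rewrite /sep -pxz.
  have [C [u [v [h [dzy duy]]]]] := IHn z dz szy.
  exists C, u, v; split=> //.
  have := dist_triangle conX x z u; have := dist_triangle conX x u y.
  by rewrite (dist_adj conX xz); lia.
have [C [cC Cx Cz]] := edge_clique xz.
exists C, x, z; split; last by rewrite (distxx conX) E dz.
by split=> //; [exact: (sep_parallel cgX cC cD Cx Cz) | exact: adj_neq].
Qed.

Lemma sep_sym C x y : sep C x y -> sep C y x.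
Proof. exact: not_eq_sym. Qed.

(** A geodesic crosses a hyperplane at most once: past a crossing edge from [u] to [v], both [z] and
    [y] are closer to [v], so both project to [v]. *)
Lemma geodesic_sep D x z y : clique D -> dist x y = (dist x z + dist z y)%N ->
  sep D x z -> ~ sep D z y.
Proof.
move=> cD dxy sxz.
have [C [u [v [[cC pCD Cu Cv nuv] [dxz dz]]]]] := sep_geodesic cD sxz.
rewrite -(sep_par _ _ cC cD pCD).
have dy : dist u y = (dist v y).+1.
  have := dist_triangle conX u v y; have := dist_triangle conX v z y.
  rewrite (clique_dist cgX cC Cu Cv nuv).
  by have := dist_triangle conX x u y; lia.
by rewrite /sep (proj_edge cgX cC Cu Cv dz) (proj_edge cgX cC Cu Cv dy).
Qed.

Definition transverse_cliques C D : Prop := forall p q, C p -> D q ->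
  exists x, gate_proj C x = p /\ gate_proj D x = q.

Lemma transverseE C D : clique C -> clique D ->
  transverse (hyp_of C) (hyp_of D) <-> transverse_cliques C D.
Proof.
move=> cC cD; split=> [t p q Cp Dq|t S T].
  have sC : sector (hyp_of C) [set y | gate_proj C y = p] by apply/(sectorE _ cC); exists p.
  have sD : sector (hyp_of D) [set y | gate_proj D y = q] by apply/(sectorE _ cD); exists q.
  by have [x [/= ? ?]] := t _ _ sC sD; exists x.
move=> /(sectorE _ cC)[p Cp ->] /(sectorE _ cD)[q Dq ->].
by have [x [? ?]] := t p q Cp Dq; exists x.
Qed.

Lemma transverse_cliques_sym C D : transverse_cliques C D -> transverse_cliques D C.
Proof. by move=> t p q Dp Cq; have [x [? ?]] := t q p Cq Dp; exists x. Qed.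

(* A geodesic from C1 to C2 that stays in a fibre of C contains an edge of the
   hyperplane of D, and the clique of that edge meets all the sectors of D. *)
Lemma transverse_cliques_grid C D C1 C2 c1 c2 : clique C -> clique D -> clique C1 -> clique C2 ->
  parallel C1 C -> parallel C2 C -> ~ parallel C D -> C1 c1 -> C2 c2 ->
  sep D c1 c2 -> transverse_cliques C D.
Proof.
move=> cC cD cC1 cC2 p1 p2 nCD Cc1 Cc2 s12 p q Cp Dq.
have npar E : clique E -> parallel E C -> ~ parallel E D.
  move=> cE pEC pED; apply: nCD; apply: (parallel_trans cC cE cD) => //.
  exact: (parallelC cgX ntX).
set a1 := gate_proj C1 p; set a2 := gate_proj C2 p.
have Ca1 : C1 a1 by exact: proj_in.
have Ca2 : C2 a2 by exact: proj_in.
have pa E : clique E -> parallel E C -> gate_proj C (gate_proj E p) = p.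
  move=> cE pEC; apply: (parallel_cancel cgX ntX) => //.
  exact: (parallelC cgX ntX).
have sa : sep D a1 a2.
  rewrite /sep (nonparallel_proj cgX cC1 cD (npar _ cC1 p1) Ca1 Cc1).
  by rewrite (nonparallel_proj cgX cC2 cD (npar _ cC2 p2) Ca2 Cc2).
have [D' [u [v [[cD' pD Du Dv nuv] [d12 _]]]]] := sep_geodesic cD sa.
have pu : gate_proj C u = p.
  apply: contrapT => npu.
  have s1 : sep C a1 u by rewrite /sep pa //; exact: not_eq_sym.
  have s2 : sep C u a2 by rewrite /sep (pa _ cC2).
  exact: (geodesic_sep cC d12 s1 s2).
have pD' : parallel D D' by exact: (parallelC cgX ntX).
exists (gate_proj D' q); split; last exact: (parallel_cancel cgX ntX).
rewrite -pu; apply: (nonparallel_proj cgX cD' cC) => //; last exact: proj_in.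
move=> pDC; apply: nCD; apply: (parallel_trans cC cD' cD) => //.
exact: (parallelC cgX ntX).
Qed.

(** Geodesics from [u] to [v] and from [x] to [y] cross the hyperplane of [C] at two cliques. As
    each crosses the hyperplane of [D] at most once, the first clique has a vertex on the side of
    [u] and the second has one off that side; [transverse_cliques_grid] applies. *)
Lemma transverse_cliques_sep C D u v x y : clique C -> clique D ->
  sep C u v -> sep C x y -> ~ sep D u v -> sep D u x -> sep D u y -> transverse_cliques C D.
Proof.
move=> cC cD suv sxy nuv sux suy.
have nCD : ~ parallel C D.
  by move=> pCD; apply: nuv; apply/(sep_par _ _ cC cD pCD).
have [C1 [e1 [f1 [[cC1 p1 Ce1 _ _] [d1 _]]]]] := sep_geodesic cC suv.
have [C2 [e2 [f2 [[cC2 p2 Ce2 _ _] [d2 _]]]]] := sep_geodesic cC sxy.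
have nue : gate_proj D u = gate_proj D e1.
  apply: contrapT => sue; apply: (geodesic_sep cD d1 sue).
  by move=> e; apply: sue; rewrite e; exact: contrapT.
have [e12|] := pselect (gate_proj D e1 = gate_proj D e2); last first.
  exact: (transverse_cliques_grid cC cD cC1 cC2).
have h w : sep D u w -> sep D e2 w by rewrite /sep nue e12.
by case: (geodesic_sep cD d2 (sep_sym (h _ sux)) (h _ suy)).
Qed.

End Paraclique.

(** * Hyperplanes along a geodesic *)

Section Geodesics.
Local Open Scope classical_set_scope.
Variable X : graph.
Hypothesis pX : paraclique X.
Hypothesis ntX : exists x y : X, x <> y.
Implicit Types (x y z : X) (C D E : set X).
Let cgX : clique_gated X := pX.1.
Let conX : connected_graph X := cgX.1.

Definition clique_path (v : nat -> X) (F : nat -> set X) (n : nat) : Prop :=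
  forall i, (i < n)%N -> [/\ clique (F i), F i (v i) & F i (v i.+1)].

Lemma geodesic_exists x y : exists v, geodesic v x y (dist x y).
Proof.
move E: (dist x y) => n; elim: n x E => [|n IHn] x E.
  exists (fun=> x); split=> //; first exact: (dist_eq0 conX E).
  by move=> i j; rewrite (distxx conX); lia.
have [z [xz dz]] := dist_step conX E.
have [v [v0 vn vE]] := IHn z dz.
have xv k : (k <= n)%N -> dist x (v k) = k.+1.
  move=> kn; have := dist_triangle conX x z (v k).
  have := dist_triangle conX x (v k) y.
  have -> : dist (v k) y = (n - k)%N by rewrite -vn vE // kn leqnn.
  have -> : dist z (v k) = k by rewrite -v0 vE ?subn0.
  by rewrite (dist_adj conX xz); lia.
exists (fun i => if i is k.+1 then v k else x); split=> // -[|i] [|j] //.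
- by rewrite (distxx conX).
- by move=> /= jn; rewrite xv // subn0.
- by rewrite !ltnS => /vE.
Qed.

Lemma geodesic_cliques v x y n : geodesic v x y n ->
  exists F, clique_path v F n.
Proof.
move=> [_ _ vE]; have /choice[F FE] : forall i, exists C, (i < n)%N ->
    [/\ clique C, C (v i) & C (v i.+1)]; last by exists F.
move=> i; have [lin|] := pselect (i < n)%N; last by exists set0.
have d1 : dist (v i) (v i.+1) = 1%N by rewrite vE ?leqnSn // subSnn.
have [z [az /(dist_eq0 conX) ez]] := dist_step conX d1.
by rewrite ez in az; have [C ?] := edge_clique az; exists C.
Qed.

(** * Hyperplanes crossed by a fixed geodesic *)

Section OneGeodesic.
Variables (v : nat -> X) (F : nat -> set X) (x y : X) (n : nat).
Hypothesis geo : geodesic v x y n.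
Hypothesis Fv : clique_path v F n.

Lemma geodesic_neq i : (i < n)%N -> v i <> v i.+1.
Proof.
move=> lin e; have [_ _ /(_ i i.+1)] := geo.
by rewrite e (distxx conX) subSnn leqnSn lin => /(_ isT).
Qed.

Lemma geodesic_proj i k : (i < n)%N -> (k <= n)%N ->
  gate_proj (F i) (v k) = if (k <= i)%N then v i else v i.+1.
Proof.
move=> lin kn; have [cF F1 F2] := Fv lin; have [_ _ vE] := geo.
case: leqP => ki; last first.
  apply: (proj_edge cgX cF F1 F2); rewrite !vE ?kn ?ki ?andbT //; last exact: ltnW.
  by rewrite subnS prednK // subn_gt0.
apply: (proj_edge cgX cF F2 F1); rewrite !(dist_sym conX _ (v k)).
by rewrite !vE ?ki ?subSn ?lin ?(ltnW lin) ?andbT // leqW.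
Qed.

(** The edge in [F i] lies on one side of every other step of the geodesic, so it projects to a
    single vertex of [F j]. *)
Lemma geodesic_nonparallel i j : (i < n)%N -> (j < n)%N -> i <> j ->
  ~ parallel (F i) (F j).
Proof.
move=> lin ljn nij pij; have [cF F1 F2] := Fv lin.
have := parallel_sep cF pij F1 F2 (geodesic_neq lin).
rewrite /sep !geodesic_proj ?(ltnW lin) //.
by case: ltngtP nij => // _ _; apply.
Qed.

Lemma geodesic_crosses i : (i < n)%N -> sep (F i) x y.
Proof.
move=> lin; have [v0 vn _] := geo; rewrite -v0 -vn /sep !geodesic_proj //.
by rewrite leq0n (leqNgt n) lin; exact: geodesic_neq.
Qed.

Lemma sep_geodesic_index D : clique D -> sep D x y ->
  exists2 i, (i < n)%N & parallel (F i) D.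
Proof.
move=> cD sxy; apply: contrapT => none; apply: sxy.
have [v0 <- _] := geo; move: (leqnn n).
elim: {-2}n => [|k IHk] kn; first by rewrite v0.
rewrite IHk ?(ltnW kn) //; have [cF F1 F2] := Fv kn.
by apply: (nonparallel_proj cgX cF cD) => // pFD; apply: none; exists k.
Qed.

End OneGeodesic.

(** Contrapositive of [transverse_cliques_grid]; it puts a non-transverse hyperplane inside one
    sector, as [lies_in] requires. *)
Lemma sides_const C D E E' e e' : clique C -> clique D -> clique E -> clique E' ->
  parallel C E -> parallel C E' -> ~ parallel C D -> ~ transverse_cliques C D ->
  E e -> E' e' -> gate_proj D e = gate_proj D e'.
Proof.
move=> cC cD cE cE' p p' nCD ntr Ee Ee'; apply: contrapT => s; apply: ntr.
by apply: (transverse_cliques_grid pX ntX cC cD cE cE') Ee Ee' s => //; exact: (parallelC cgX ntX).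
Qed.

Lemma separates_mid C D E c e : clique C -> clique D -> clique E ->
  ~ parallel C D -> ~ parallel E D -> ~ transverse_cliques C D -> ~ transverse_cliques E D ->
  C c -> E e -> sep D c e -> separates (hyp_of D) (hyp_of C) (hyp_of E).
Proof.
move=> cC cD cE nCD nED tCD tED Cc Ee s.
have sec z : sector (hyp_of D) [set w | gate_proj D w = gate_proj D z].
  by apply/(sectorE pX ntX _ cD); exists (gate_proj D z) => //; exact: proj_in.
exists [set w | gate_proj D w = gate_proj D c], [set w | gate_proj D w = gate_proj D e].
have lies A a : clique A -> ~ parallel A D -> ~ transverse_cliques A D -> A a ->
    lies_in (hyp_of A) [set w | gate_proj D w = gate_proj D a].
  move=> cA nA tA Aa u w [B [cB pB [/= Bu Bw _]]].
  by split=> /=; apply: (sides_const cA cD cB cA pB _ nA tA) => //;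
    exact: (parallel_refl cgX ntX).
split=> //; [|exact: lies|exact: lies].
by rewrite predeqE => /(_ c)[/(_ erefl) e' _]; exact: s.
Qed.

Lemma separates_sym (J H K : set (X * X)) : separates J H K -> separates J K H.
Proof.
by move=> [S [T [sS sT nST HS KT]]]; exists T, S; split=> // e; apply: nST.
Qed.

Lemma transverse_sym (H K : set (X * X)) : transverse H K -> transverse K H.
Proof. by move=> t S T sS sT; rewrite setIC; exact: t. Qed.

(** A geodesic from [x] to [y] crosses the three hyperplanes in some order; if they are distinct and
    pairwise non-transverse, the middle one separates the other two. *)
Lemma no_facing_triple C1 C2 C3 x y : clique C1 -> clique C2 -> clique C3 ->
  sep C1 x y -> sep C2 x y -> sep C3 x y ->
  ~ facing_triple (hyp_of C1) (hyp_of C2) (hyp_of C3).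
Proof.
move=> c1 c2 c3 s1 s2 s3.
have [v geo] := geodesic_exists x y; have [F Fv] := geodesic_cliques geo.
move: geo Fv; set n := dist x y => geo Fv.
have idx C : clique C -> sep C x y -> exists2 i, (i < n)%N & hyp_of C = hyp_of (F i).
  move=> cC sC; have [i lin pi] := sep_geodesic_index geo Fv cC sC.
  by exists i => //; rewrite (hyp_of_par pX ntX _ _ pi) //; have [] := Fv i lin.
have [i lin ->] := idx _ c1 s1; have [j ljn ->] := idx _ c2 s2.
have [k lkn ->] := idx _ c3 s3.
have mid a b c : (a < b)%N -> (b < c)%N -> (c < n)%N ->
    ~ transverse (hyp_of (F a)) (hyp_of (F b)) ->
    ~ transverse (hyp_of (F b)) (hyp_of (F c)) ->
    separates (hyp_of (F b)) (hyp_of (F a)) (hyp_of (F c)).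
  move=> ab bc cn; have bn := ltn_trans bc cn; have an := ltn_trans ab bn.
  have [ca Fa _] := Fv a an; have [cb _ _] := Fv b bn; have [cc Fc _] := Fv c cn.
  rewrite !transverseE // => tab tbc.
  apply: (separates_mid ca cb cc _ _ tab _ Fa Fc).
  - by apply: (geodesic_nonparallel geo Fv) => //; lia.
  - by apply: (geodesic_nonparallel geo Fv) => //; lia.
  - by move=> /transverse_cliques_sym.
  - rewrite /sep !(geodesic_proj geo Fv) ?(ltnW an) ?(ltnW cn) //.
    by rewrite (ltnW ab) leqNgt bc; exact: (geodesic_neq geo).
move=> [[nij nik njk] [[tij tik tjk] [s1' s2' s3']]].
have tji := contra_not (@transverse_sym _ _) tij.
have tki := contra_not (@transverse_sym _ _) tik.
have tkj := contra_not (@transverse_sym _ _) tjk.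
case: (ltngtP i j) => [ij|ji|e]; last by apply: nij; rewrite e.
  case: (ltngtP j k) => [jk|kj|e]; last by apply: njk; rewrite e.
    by apply: s2'; exact: mid.
  case: (ltngtP i k) => [ik|ki|e]; last by apply: nik; rewrite e.
    by apply: s3'; exact: mid.
  by apply: s1'; apply: separates_sym; exact: mid.
case: (ltngtP i k) => [ik|ki|e]; last by apply: nik; rewrite e.
  by apply: s1'; exact: mid.
case: (ltngtP j k) => [jk|kj|e]; last by apply: njk; rewrite e.
  by apply: s3'; apply: separates_sym; exact: mid.
by apply: s2'; apply: separates_sym; exact: mid.
Qed.

End Geodesics.

(** * The extended metric as a sum over hyperplanes *)

Section ExtendedMetric.
Local Open Scope classical_set_scope.
Local Open Scope ring_scope.
Variables (X : graph) (R : realType) (delta : set X -> X -> X -> R).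
Hypothesis pX : paraclique X.
Hypothesis ntX : exists x y : X, x <> y.
Hypothesis mdelta : metric_system delta.
Hypothesis cdelta : coherent delta.
Implicit Types (x y z o : X) (C D : set X).
Let cgX : clique_gated X := pX.1.
Let conX : connected_graph X := cgX.1.

(** The contribution of the hyperplane of [C] to the extended metric; by [proj_delta_par] it does
    not depend on the representative. *)
Definition proj_delta C x y : R := delta C (gate_proj C x) (gate_proj C y).

Lemma proj_delta_ge0 C x y : clique C -> 0 <= proj_delta C x y.
Proof. by move=> cC; have [h _ _ _] := mdelta cC; apply: h; exact: proj_in. Qed.

Lemma proj_delta_eq0 C x y : clique C -> ~ sep C x y -> proj_delta C x y = 0.
Proof.
move=> cC /contrapT e; have [_ h _ _] := mdelta cC.
by apply/h => //; exact: proj_in.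
Qed.

Lemma proj_delta_gt0 C x y : clique C -> sep C x y -> 0 < proj_delta C x y.
Proof.
move=> cC s; rewrite lt_neqAle proj_delta_ge0 // andbT eq_sym; apply/eqP => e.
by apply: s; have [_ h _ _] := mdelta cC; apply/h => //; exact: proj_in.
Qed.

Lemma proj_delta_sym C x y : clique C -> proj_delta C x y = proj_delta C y x.
Proof. by move=> cC; have [_ _ h _] := mdelta cC; apply: h; exact: proj_in. Qed.

Lemma proj_delta_triangle C x y z : clique C ->
  proj_delta C x z <= proj_delta C x y + proj_delta C y z.
Proof. by move=> cC; have [_ _ _ h] := mdelta cC; apply: h; exact: proj_in. Qed.

Lemma proj_delta_par C D x y : clique C -> clique D -> parallel C D ->
  proj_delta C x y = proj_delta D x y.
Proof.
move=> cC cD pCD; rewrite /proj_delta -(cdelta cC cD pCD); try exact: proj_in.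
have pE z : gate_proj D (gate_proj C z) = gate_proj D z.
  apply: contrapT => /(sep_par pX ntX _ _ cC cD pCD).
  by rewrite /sep (proj_id cgX cC) //; exact: proj_in.
by rewrite !pE.
Qed.

Lemma proj_delta_id C x y : clique C -> C x -> C y -> proj_delta C x y = delta C x y.
Proof. by move=> cC Cx Cy; rewrite /proj_delta !(proj_id cgX cC). Qed.

(** Cliques stand for their hyperplanes, assumed distinct; the predicate [P] selects subfamilies
    without reindexing. *)
Definition nonparallel_family (I : finType) (P : pred I) (E : I -> set X) : Prop :=
  (forall i, P i -> clique (E i)) /\
  (forall i j, P i -> P j -> i <> j -> ~ parallel (E i) (E j)).

(** An edge of [C] is crossed only by the hyperplane of [C], so at most one term is non-zero, and it
    equals [delta C x y]. *)
Lemma proj_delta_family_edge (I : finType) (P : pred I) E C x y :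
  nonparallel_family P E -> clique C -> C x -> C y ->
  \sum_(i | P i) proj_delta (E i) x y <= delta C x y.
Proof.
move=> [cE nE] cC Cx Cy; rewrite -(proj_delta_id cC Cx Cy).
have [[i [Pi si]]|none] := pselect (exists i, P i /\ sep (E i) x y); last first.
  rewrite big1 ?proj_delta_ge0 // => i Pi.
  by apply: proj_delta_eq0; [exact: cE|move=> s; apply: none; exists i].
have pCE D : clique D -> sep D x y -> parallel C D.
  by move=> cD; exact: (sep_parallel cgX cC cD Cx Cy).
have cEi := cE _ Pi.
rewrite (bigD1 i) //= big1 ?addr0 => [|j /andP[Pj /eqP nji]].
  by rewrite (proj_delta_par _ _ cC cEi) //; exact: pCE.
apply: proj_delta_eq0 => [|sj]; first exact: cE.
have cEj := cE _ Pj.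
apply: (nE j i) => //; apply: (parallel_trans pX cEj cC cEi (parallelC cgX ntX _ _ _)) => //.
  exact: pCE.
exact: pCE.
Qed.

Definition chain_lengths x y : set R :=
  [set s | exists (n : nat) (v : nat -> X) (C : nat -> set X),
    [/\ v 0%N = x, v n = y,
        forall i, (i < n)%N -> [/\ clique (C i), C i (v i) & C i (v i.+1)]
      & s = \sum_(i < n) delta (C i) (v i) (v i.+1)]].

Lemma proj_delta_family_chain (I : finType) (P : pred I) E x y s :
  nonparallel_family P E -> chain_lengths x y s ->
  \sum_(i | P i) proj_delta (E i) x y <= s.
Proof.
move=> nE [n [v [C [<- <- Cv ->]]]].
elim: n Cv => [|n IHn] Cv.
  rewrite big_ord0 big1 // => i Pi; apply: proj_delta_eq0; first exact: nE.1.
  by move=> s0; apply: s0.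
rewrite big_ord_recr /=.
apply: (@le_trans _ _ (\sum_(i | P i) proj_delta (E i) (v 0%N) (v n) +
                       \sum_(i | P i) proj_delta (E i) (v n) (v n.+1))).
  rewrite -big_split; apply: ler_sum => i Pi.
  by apply: proj_delta_triangle; exact: nE.1.
apply: lerD; first by apply: IHn => i lin; apply: Cv; exact: ltnW.
by have [cC C1 C2] := Cv n (ltnSn n); exact: proj_delta_family_edge.
Qed.

(** The equality forces the list to be complete: a missing separating hyperplane would push the
    lower bound of [ext_metric_lb] above the metric. *)
Definition geodesic_family x y n (E : 'I_n -> set X) : Prop :=
  [/\ nonparallel_family xpredT E, forall i, sep (E i) x y &
      ext_metric delta x y = \sum_i proj_delta (E i) x y].

(** A geodesic for [dist] is such a chain: its edge in [F i] joins the projections of [x] and [y] to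
    [F i]. *)
Lemma chain_exists x y : exists n (E : 'I_n -> set X),
  [/\ nonparallel_family xpredT E, forall i, sep (E i) x y,
      x <> y -> (0 < n)%N & chain_lengths x y (\sum_i proj_delta (E i) x y)].
Proof.
have [v geo] := geodesic_exists pX x y; have [F Fv] := geodesic_cliques pX geo.
exists (dist x y), (fun i => F i); have [v0 vn _] := geo.
split.
- split=> [i _|i j _ _ nij]; first by have [] := Fv i (ltn_ord i).
  by apply: (geodesic_nonparallel pX geo Fv) => // e; apply: nij; exact: val_inj.
- by move=> i; exact: (geodesic_crosses pX geo Fv).
- by move=> nxy; rewrite lt0n; apply/eqP => /(dist_eq0 conX).
exists (dist x y), v, F; split=> //; apply: eq_bigr => i _.
have [cF F1 F2] := Fv i (ltn_ord i).
have := geodesic_proj pX geo Fv (ltn_ord i) (leq0n _).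
have := geodesic_proj pX geo Fv (ltn_ord i) (leqnn _).
by rewrite v0 vn leq0n leqNgt ltn_ord /proj_delta => -> ->.
Qed.

Lemma ext_metric_lb (I : finType) (P : pred I) (E : I -> set X) x y :
  nonparallel_family P E ->
  \sum_(i | P i) proj_delta (E i) x y <= ext_metric delta x y.
Proof.
move=> nE; apply: lb_le_inf.
  by have [n [F [_ _ _ h]]] := chain_exists x y; exists (\sum_i proj_delta (F i) x y).
by move=> s; exact: proj_delta_family_chain.
Qed.

Lemma geodesic_family_exists x y : exists n (E : 'I_n -> set X),
  geodesic_family x y E /\ (x <> y -> (0 < n)%N).
Proof.
have [n [E [nE sE n0 chE]]] := chain_exists x y; exists n, E; split=> //.
split=> //; apply/eqP; rewrite eq_le ext_metric_lb // andbT.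
(* An infimum in [R] requires a lower bound; the empty family gives 0. *)
apply: ge_inf => //; exists 0 => s.
have n00 : nonparallel_family (pred0 : pred 'I_0) (fun=> set0) by split.
by move=> /(proj_delta_family_chain n00); rewrite big_pred0.
Qed.

Lemma ext_metric_ge0 x y : 0 <= ext_metric delta x y.
Proof.
have [n [E [[[cE _] _ ->] _]]] := geodesic_family_exists x y.
by apply: sumr_ge0 => i _; apply: proj_delta_ge0; exact: cE.
Qed.

Lemma ext_metric_gt0 x y : x <> y -> 0 < ext_metric delta x y.
Proof.
move=> nxy; have [n [E [[[cE _] sE ->] /(_ nxy)]]] := geodesic_family_exists x y.
case: n E cE sE => // n E cE sE _; rewrite big_ord_recl.
apply: ltr_wpDr; last by apply: proj_delta_gt0; [exact: cE|exact: sE].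
by apply: sumr_ge0 => i _; apply: proj_delta_ge0; exact: cE.
Qed.

Lemma ext_metric_sym x y : ext_metric delta x y = ext_metric delta y x.
Proof.
suff le u v : ext_metric delta u v <= ext_metric delta v u.
  by apply/eqP; rewrite eq_le !le.
have [n [E [[nE _ ->] _]]] := geodesic_family_exists u v.
rewrite (eq_bigr (fun i => proj_delta (E i) v u)); first exact: ext_metric_lb.
by move=> i _; apply: proj_delta_sym; exact: nE.1.
Qed.

Lemma ext_metric_triangle x y z :
  ext_metric delta x z <= ext_metric delta x y + ext_metric delta y z.
Proof.
have [n [E [[nE _ ->] _]]] := geodesic_family_exists x z.
apply: le_trans (lerD (ext_metric_lb x y nE) (ext_metric_lb y z nE)).
rewrite -big_split; apply: ler_sum => i _.
by apply: proj_delta_triangle; exact: nE.1.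
Qed.

Lemma ext_metric_xx x : ext_metric delta x x = 0.
Proof.
have [n [E [[_ sE ->] _]]] := geodesic_family_exists x x.
by rewrite big1 // => i _; case: (sE i).
Qed.

(* Only the hyperplanes separating o from both x and y make the triangle
   inequality through o strict. *)
Lemma ext_metric_defect x o y n m (E : 'I_n -> set X) (F : 'I_m -> set X) :
  geodesic_family o x E -> geodesic_family o y F ->
  ext_metric delta o x + ext_metric delta o y <= ext_metric delta x y +
    (\sum_(i | `[< sep (E i) o y >]) proj_delta (E i) o x +
     \sum_(j | `[< sep (F j) o x >]) proj_delta (F j) o y).
Proof.
move=> [nE sE ->] [nF sF ->].
(* Hyperplanes separating [o] from both [x] and [y] are discarded. The rest of the two families have
   no hyperplane in common, and each one left contributes to the distance from [x] to [y] what it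
   contributes to its own sum. *)
pose PE i := ~~ `[< sep (E i) o y >]; pose PF j := ~~ `[< sep (F j) o x >].
pose H (k : 'I_n + 'I_m) := match k with inl i => E i | inr j => F j end.
pose P (k : 'I_n + 'I_m) := match k with inl i => PE i | inr j => PF j end.
have cE i := nE.1 i isT; have cF i := nF.1 i isT.
have nEF i j : PE i -> ~ parallel (E i) (F j).
  by move=> /asboolPn ns p; apply: ns; apply/(sep_par pX ntX _ _ (cE i) (cF j) p).
have nH : nonparallel_family P H.
  split=> [[i|j] _ /=|[i|i] [j|j] /= Pi Pj nij].
  - exact: cE.
  - exact: cF.
  - by apply: nE.2 => // e; apply: nij; rewrite e.
  - exact: nEF.
  - by move=> /(parallelC cgX ntX (cF _) (cE _)); exact: nEF.
  - by apply: nF.2 => // e; apply: nij; rewrite e.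
have := ext_metric_lb x y nH; rewrite big_sumType /=.
rewrite (eq_bigr (fun i => proj_delta (E i) o x)); last first.
  move=> i /asboolPn /contrapT e; rewrite proj_delta_sym //.
  by rewrite /proj_delta e.
rewrite (eq_bigr (fun j => proj_delta (F j) o y)); last first.
  by move=> j /asboolPn /contrapT e; rewrite /proj_delta e.
rewrite [X in _ -> X + _ <= _](bigID (fun i => `[< sep (E i) o y >])) /=.
rewrite [X in _ -> _ + X <= _](bigID (fun j => `[< sep (F j) o x >])) /=.
rewrite /PE /PF; lra.
Qed.

(** By [geodesic_sep] no hyperplane separates [o] from both ends, so the defect vanishes. *)
Lemma ext_metric_geodesic x o y : dist x y = (dist x o + dist o y)%N ->
  ext_metric delta x o + ext_metric delta o y = ext_metric delta x y.
Proof.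
move=> geo; apply/eqP; rewrite eq_le ext_metric_triangle andbT.
have [n [E [hE _]]] := geodesic_family_exists o x.
have [m [F [hF _]]] := geodesic_family_exists o y.
have := ext_metric_defect hE hF; rewrite (ext_metric_sym x o) => h.
apply: le_trans h _; rewrite !big1 ?addr0 // => i /asboolP s; exfalso.
  have [[cF _] sF _] := hF.
  exact: (geodesic_sep pX ntX (cF i isT) geo (sep_sym s) (sF i)).
have [[cE _] sE _] := hE.
exact: (geodesic_sep pX ntX (cE i isT) geo (sep_sym (sE i)) s).
Qed.

(* A hyperplane E separating o from x and y, but not from q, is transverse to
   C1 and C2. The o-y separation of all the E i excludes facing triples, which is
   how well-separation enters; this form moves under G by moving points. *)
Definition sep_bounded (C1 C2 : set X) (L : R) : Prop :=
  forall o q x y, sep C1 o q -> sep C2 o q -> sep C1 x y -> sep C2 x y ->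
  forall n (E : 'I_n -> set X) (P : pred 'I_n), nonparallel_family P E ->
  (forall i, P i -> [/\ sep (E i) o x, sep (E i) o y & ~ sep (E i) o q]) ->
  \sum_(i | P i) proj_delta (E i) o y <= L.

Lemma proj_delta_thick C x y : clique C ->
  ((proj_delta C x y)%:E <= thick delta (hyp_of C))%E.
Proof.
move=> cC; have [D [cD pCD thE]] : exists D,
    [/\ clique D, parallel C D & thick delta (hyp_of C) = clique_diam delta D].
  (* [C] itself qualifies, which excludes the default; by [clique_uniq] the clique picked is
     parallel to [C]. *)
  rewrite /thick; case: xgetP => [D _ [cD eD]|none]; last first.
    exfalso; apply: (none C); split=> // xy exy.
    by exists C; split=> //; exact: (parallel_refl cgX ntX).
  exists D; split=> //; have [u [v [Du Dv nuv]]] := clique_pair cgX ntX cD.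
  have [|F [cF pCF [/= Fu Fv _]]] := eD (u, v).
    by split=> //=; exact: (clique_adj cD).
  by rewrite (clique_uniq cgX cD cF nuv).
rewrite (proj_delta_par _ _ cC cD pCD) thE; apply: ereal_sup_ubound.
by exists (gate_proj D x), (gate_proj D y); split=> //; exact: proj_in.
Qed.

Lemma well_separated_sep_bounded C1 C2 : clique C1 -> clique C2 ->
  well_separated delta (hyp_of C1) (hyp_of C2) ->
  exists2 L, 0 <= L & sep_bounded C1 C2 L.
Proof.
move=> c1 c2 [L L0 wsL]; exists L => // o q x y s1 s2 t1 t2 n E P [cE nE] sE.
(* [well_separated] expects an injective family indexed by an ordinal, so the subfamily selected by
   [P] is enumerated. *)
pose J (k : 'I_#|P|) := hyp_of (E (enum_val k)).
have PE (k : 'I_#|P|) : P (enum_val k) by exact: (enum_valP k).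
have tr (k : 'I_#|P|) C : clique C -> sep C o q -> sep C x y -> transverse (J k) (hyp_of C).
  move=> cC sq sxy; have [sx sy nq] := sE _ (PE k); have cEk := cE _ (PE k).
  by apply: transverse_sym; apply/(transverseE pX ntX cC cEk);
    exact: (transverse_cliques_sep pX ntX cC cEk sq sxy nq sx sy).
rewrite -lee_fin; apply: le_trans (wsL _ J _ _ _).
- rewrite -sumEFin big_enum_val /=.
  by apply: lee_sum => k _; apply: proj_delta_thick; exact: cE.
- move=> k l; rewrite /J => e; apply: enum_val_inj; apply: contrapT => ne.
  apply: (nE _ _ (PE k) (PE l) ne).
  by apply: (hyp_of_inj pX ntX) => //; exact: cE.
- move=> k; split; [by exists (E (enum_val k)) => //; exact: cE| exact: tr|exact: tr].
- move=> i j k.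
  have [_ si _] := sE _ (PE i); have [_ sj _] := sE _ (PE j).
  have [_ sk _] := sE _ (PE k).
  by apply: (no_facing_triple pX ntX _ _ _ si sj sk); exact: cE.
Qed.

(* A hyperplane separating o from y meets at most one of the halves [q, o]
   and [o, q'] of a geodesic, so it crosses A1 and A2, or B1 and B2. *)
Lemma sep_bounded_defect A1 A2 B1 B2 L o q q' x y n (E : 'I_n -> set X) :
  sep_bounded A1 A2 L -> sep_bounded B1 B2 L ->
  dist q q' = (dist q o + dist o q')%N ->
  sep A1 o q -> sep A2 o q -> sep A1 x y -> sep A2 x y ->
  sep B1 o q' -> sep B2 o q' -> sep B1 x y -> sep B2 x y ->
  geodesic_family o y E ->
  \sum_(i | `[< sep (E i) o x >]) proj_delta (E i) o y <= L + L.
Proof.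
move=> bA bB geo a1 a2 a3 a4 b1 b2 b3 b4 [[cE nE] sE _].
have nP (P : pred 'I_n) : nonparallel_family P E.
  by split=> [i _|i j _ _]; [exact: cE | exact: nE].
rewrite (bigID (fun i => `[< sep (E i) o q >])) /= addrC; apply: lerD.
  apply: (bA o q x y a1 a2 a3 a4 n E _ (nP _)) => i /andP[/asboolP s /asboolPn s'].
  by split.
apply: (bB o q' x y b1 b2 b3 b4 n E _ (nP _)) => i /andP[/asboolP s /asboolP s'].
by split=> //; exact: (geodesic_sep pX ntX (cE i isT) geo (sep_sym s')).
Qed.

(** The defect is two sums, exchanged by swapping [x] and [y]; each is at most [2 * L]. *)
Lemma ext_metric_thin A1 A2 B1 B2 L o q q' x y :
  sep_bounded A1 A2 L -> sep_bounded B1 B2 L ->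
  dist q q' = (dist q o + dist o q')%N ->
  sep A1 o q -> sep A2 o q -> sep A1 x y -> sep A2 x y ->
  sep B1 o q' -> sep B2 o q' -> sep B1 x y -> sep B2 x y ->
  ext_metric delta o x + ext_metric delta o y <= ext_metric delta x y + 4 * L.
Proof.
move=> bA bB geo a1 a2 a3 a4 b1 b2 b3 b4.
have [n [E [hE _]]] := geodesic_family_exists o x.
have [m [F [hF _]]] := geodesic_family_exists o y.
have := ext_metric_defect hE hF.
have := sep_bounded_defect bA bB geo a1 a2 (sep_sym a3) (sep_sym a4) b1 b2
  (sep_sym b3) (sep_sym b4) hE.
have := sep_bounded_defect bA bB geo a1 a2 a3 a4 b1 b2 b3 b4 hF.
lra.
Qed.

End ExtendedMetric.

(** * Group action *)

Section GraphAction.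
Local Open Scope classical_set_scope.
Local Open Scope ring_scope.
Variables (G : groupType) (X : graph) (a : graph_action G X).
Hypothesis pX : paraclique X.
Hypothesis ntX : exists x y : X, x <> y.
Implicit Types (g h : G) (x y z o : X) (C D : set X).
Let cgX : clique_gated X := pX.1.
Let conX : connected_graph X := cgX.1.

Lemma actK g x : a g^-1%g (a g x) = x.
Proof. by rewrite -actM mulVg act1. Qed.

Lemma actVK g x : a g (a g^-1%g x) = x.
Proof. by rewrite -actM mulgV act1. Qed.

Lemma act_inj g : injective (a g).
Proof. by move=> x y e; rewrite -(actK g x) e actK. Qed.

Lemma dist_act g x y : dist (a g x) (a g y) = dist x y.
Proof.
have le h u v : (dist (a h u) (a h v) <= dist u v)%N.
  have [[p [pp <- <-]] _] := dist_spec conX u v.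
  apply: (dist_spec conX _ _).2; exists (map (a h) p).
  rewrite last_map size_map path_map; split=> //.
  by rewrite (eq_path (e' := @adj X)) // => ? ?; rewrite /= act_adj.
by apply/eqP; rewrite eqn_leq le /= -{1}(actK g x) -{1}(actK g y) le.
Qed.

Lemma image_act g C x : (a g @` C) (a g x) <-> C x.
Proof. by split=> [[y Cy /act_inj <-]|Cx] //; exists x. Qed.

Lemma clique_act g C : clique C -> clique (a g @` C).
Proof.
move=> [cC maxC]; split=> [_ _ [x Cx <-] [y Cy <-] nxy|Y cY CY].
  by rewrite act_adj; apply: cC => // e; apply: nxy; rewrite e.
rewrite -(maxC [set x | Y (a g x)]).
- rewrite eqEsubset; split=> [y Yy|_ [x Yx <-] //].
  by exists (a g^-1%g y); rewrite /= actVK.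
- move=> x y Yx Yy nxy; rewrite -(act_adj a g); apply: cY => // e.
  by apply: nxy; exact: act_inj e.
- by move=> x Cx; apply: CY; exists x.
Qed.

Lemma proj_act g C x : clique C ->
  gate_proj (a g @` C) (a g x) = a g (gate_proj C x).
Proof.
move=> cC; apply: (proj_uniq cgX (clique_act g cC)).
  by apply/image_act; exact: proj_in.
by move=> _ [c Cc <-]; rewrite !dist_act; exact: (proj_dist cgX).
Qed.

Lemma sep_act g C x y : clique C -> sep (a g @` C) (a g x) (a g y) <-> sep C x y.
Proof.
move=> cC; rewrite /sep !proj_act //; split; first by apply: contra_not => ->.
by apply: contra_not; exact: act_inj.
Qed.

Lemma parallel_act g C D : clique C -> clique D -> parallel C D ->
  parallel (a g @` C) (a g @` D).
Proof.
move=> cC cD pCD; have [x [y [Cx Cy nxy]]] := clique_pair cgX ntX cC.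
apply: (sep_parallel cgX (clique_act g cC) (clique_act g cD) (x := a g x) (y := a g y)).
- exact/image_act.
- exact/image_act.
- by apply/(sep_act g _ _ cD); exact: (parallel_sep cC pCD).
Qed.

Lemma image_actK g C : a g^-1%g @` (a g @` C) = C.
Proof.
rewrite eqEsubset; split=> [_ [_ [x Cx <-] <-]|x Cx]; first by rewrite actK.
by exists (a g x); [exists x | rewrite actK].
Qed.

Lemma nonparallel_act g C D : clique C -> clique D -> ~ parallel C D ->
  ~ parallel (a g @` C) (a g @` D).
Proof.
move=> cC cD; apply: contra_not => /(parallel_act g^-1%g).
by rewrite !image_actK; apply; exact: clique_act.
Qed.

(** * Invariance of the extended metric *)

Section InvariantMetric.
Variables (R : realType) (delta : set X -> X -> X -> R).
Hypothesis mdelta : metric_system delta.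
Hypothesis cdelta : coherent delta.
Hypothesis idelta : invariant_system a delta.

Lemma proj_delta_act g C x y : clique C ->
  proj_delta delta (a g @` C) (a g x) (a g y) = proj_delta delta C x y.
Proof. by move=> cC; rewrite /proj_delta !proj_act // idelta //; exact: proj_in. Qed.

Lemma nonparallel_family_act g (I : finType) (P : pred I) (E : I -> set X) :
  nonparallel_family P E -> nonparallel_family P (fun i => a g @` E i).
Proof.
move=> [cE nE]; split=> [i Pi|i j Pi Pj nij]; first exact/clique_act/cE.
by apply: nonparallel_act; [exact: cE|exact: cE|exact: nE].
Qed.

Lemma ext_metric_act g x y :
  ext_metric delta (a g x) (a g y) = ext_metric delta x y.
Proof.
have le h u v : ext_metric delta u v <= ext_metric delta (a h u) (a h v).
  have [n [E [[nE _ ->] _]]] := geodesic_family_exists pX ntX mdelta cdelta u v.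
  rewrite (eq_bigr (fun i => proj_delta delta (a h @` E i) (a h u) (a h v))).
    apply: (ext_metric_lb pX ntX mdelta cdelta); exact: nonparallel_family_act.
  by move=> i _; rewrite proj_delta_act //; exact: nE.1.
by apply/eqP; rewrite eq_le le andbT -{2}(actK g x) -{2}(actK g y) le.
Qed.

Lemma sep_bounded_act g C1 C2 L : clique C1 -> clique C2 ->
  sep_bounded delta C1 C2 L -> sep_bounded delta (a g @` C1) (a g @` C2) L.
Proof.
move=> c1 c2 bL o q x y s1 s2 t1 t2 n E P nE sE.
have cE := nE.1.
have pull C u v : clique C -> sep (a g @` C) u v -> sep C (a g^-1%g u) (a g^-1%g v).
  by move=> cC s; apply/(sep_act g _ _ cC); rewrite !actVK.
rewrite (eq_bigr (fun i => proj_delta delta (a g^-1%g @` E i) (a g^-1%g o) (a g^-1%g y))).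
  apply: (bL _ (a g^-1%g q) (a g^-1%g x)); try exact: pull.
    exact: nonparallel_family_act.
  move=> i Pi; have [sx sy nq] := sE i Pi; have cEi := cE i Pi.
  by split; [exact/sep_act|exact/sep_act|move/(sep_act _ _ _ cEi)].
by move=> i Pi; rewrite proj_delta_act //; exact: cE.
Qed.

End InvariantMetric.

Lemma zexpgS g (m : int) : zexpg g (m + 1) = (g * zexpg g m)%g.
Proof.
case: m => [n|[|n]].
- by rewrite -PoszD addn1 /= expgS.
- by rewrite /= expg1 mulgV.
- have -> : Negz n.+1 + 1 = Negz n by rewrite !NegzE; lia.
  by rewrite /= (expgSr g n.+1) invgM mulgA mulgV mul1g.
Qed.

Lemma zexpgN g (m : int) : zexpg g (- m) = (zexpg g m)^-1%g.
Proof.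
case: m => [[|n]|n].
- by rewrite oppr0 /= invg1.
- by rewrite -NegzE.
- by rewrite NegzE opprK /= invgK.
Qed.

Lemma act_zexpgD g (m n : int) x :
  a (zexpg g (m + n)) x = a (zexpg g m) (a (zexpg g n) x).
Proof.
have pos (k : nat) (j : int) y : a (zexpg g (k%:Z + j)) y = a (zexpg g k) (a (zexpg g j) y).
  elim: k => [|k IHk]; first by rewrite add0r /= act1.
  rewrite intS -addrA addrC zexpgS actM IHk.
  by rewrite [in RHS]addrC zexpgS actM.
case: m => k; first exact: pos.
rewrite NegzE; apply: (@act_inj (zexpg g k.+1)).
by rewrite -[LHS]pos addrA subrr add0r zexpgN actVK.
Qed.

Lemma act_translation (gam : int -> X) g (t : int) :
  (forall i, a g (gam i) = gam (i + t)) ->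
  forall (k i : int), a (zexpg g k) (gam i) = gam (i + k * t).
Proof.
move=> gt; have pos (k : nat) i : a (zexpg g k) (gam i) = gam (i + k%:Z * t).
  elim: k => [|k IHk]; first by rewrite /= act1 mul0r addr0.
  by rewrite intS addrC zexpgS actM IHk gt; congr gam; lia.
case=> k i; first exact: pos.
rewrite NegzE; apply: (@act_inj (zexpg g k.+1)).
by rewrite zexpgN actVK pos; congr gam; lia.
Qed.

End GraphAction.

(** * Levels of a skewering element *)

Section Skewering.
Local Open Scope classical_set_scope.
Local Open Scope ring_scope.
Variables (G : groupType) (X : graph) (a : graph_action G X) (h : G).
Hypothesis pX : paraclique X.
Hypothesis ntX : exists x y : X, x <> y.
Variables (C1 C2 : set X) (c1 c2 : X).
Hypotheses (cC1 : clique C1) (cC2 : clique C2).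
Hypothesis sub21 : forall x, gate_proj C2 x = c2 -> gate_proj C1 x = c1.
Hypothesis sub12 : forall x, gate_proj C1 x = c1 -> gate_proj C2 (a h x) = c2.
Hypothesis proper12 : exists2 y, gate_proj C2 y = c2 &
  forall x, gate_proj C1 x = c1 -> a h x <> y.
Implicit Types (x y z : X) (C : set X) (i j k : int).
Let cgX : clique_gated X := pX.1.
Let conX : connected_graph X := cgX.1.

(* x lies in the translate by h^j of the sector [gate_proj C = c]. *)
Definition in_translate C c j x : Prop :=
  gate_proj (a (zexpg h j) @` C) x = a (zexpg h j) c.

Lemma in_translateE C c j x : clique C ->
  in_translate C c j (a (zexpg h j) x) <-> gate_proj C x = c.
Proof.
by move=> cC; rewrite /in_translate (proj_act _ pX) //; split=> [/act_inj|->].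
Qed.

Lemma in_translateP C c j x : clique C ->
  in_translate C c j x <-> gate_proj C (a (zexpg h j)^-1%g x) = c.
Proof. by move=> cC; rewrite -(in_translateE c j _ cC) actVK. Qed.

Lemma in_translate_act C c j k x : clique C ->
  in_translate C c (k + j) (a (zexpg h k) x) <-> in_translate C c j x.
Proof.
move=> cC; rewrite -{1}(actVK a (zexpg h j) x) -act_zexpgD in_translateE //.
by rewrite in_translateP.
Qed.

Lemma in_translate21 j x : in_translate C2 c2 j x -> in_translate C1 c1 j x.
Proof. by rewrite !in_translateP //; exact: sub21. Qed.

Lemma in_translate12 j x : in_translate C1 c1 (j + 1) x -> in_translate C2 c2 j x.
Proof.
rewrite -{1}(actVK a (zexpg h (j + 1)) x) in_translateE // => /sub12.
move=> e; rewrite in_translateP // -e; congr gate_proj.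
apply: (@act_inj _ _ a (zexpg h j)).
have -> : h = zexpg h 1 by [].
by rewrite actVK -act_zexpgD actVK.
Qed.

(** With S1, S2 the sectors over [c1], [c2]: h^j S1 contains h^j S2, which contains h^(j+1) S1. *)
Lemma in_translate_le i j x : i <= j -> in_translate C1 c1 j x -> in_translate C1 c1 i x.
Proof.
move=> ij; have -> : j = i + `|j - i|%N%:Z by lia.
elim: `|j - i|%N => [|n IHn]; first by rewrite addr0.
by rewrite intS (addrC 1) addrA => /in_translate12/in_translate21/IHn.
Qed.

(* The sectors h^j S1 decrease with j; the level of x is the last one containing x. *)
Definition level k x : Prop :=
  in_translate C1 c1 k x /\ ~ in_translate C1 c1 (k + 1) x.

Lemma level_in k x j : level k x -> in_translate C1 c1 j x <-> j <= k.
Proof.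
move=> [ik nk]; split=> [ij|jk]; last exact: in_translate_le ik.
by rewrite leNgt; apply/negP => kj; apply: nk; apply: in_translate_le ij; lia.
Qed.

Lemma level_in2 k x j : level k x -> j < k -> in_translate C2 c2 j x.
Proof. by move=> lx jk; apply/in_translate12/(level_in _ lx); lia. Qed.

Lemma level_nin2 k x j : level k x -> k < j -> ~ in_translate C2 c2 j x.
Proof. by move=> lx kj /in_translate21/(level_in _ lx); lia. Qed.

Lemma level_sep k l x y j : level k x -> level l y -> k < j <= l ->
  sep (a (zexpg h j) @` C1) x y.
Proof.
move=> lx ly /andP[kj jl] e; have := (level_in j ly).2 jl.
by rewrite /in_translate -e => /(level_in j lx); lia.
Qed.

(** The sector h^j S2 sits somewhere between h^j S1 and h^(j+1) S1, hence the strict [j < l], unlike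
    in [level_sep]. *)
Lemma level_sep2 k l x y j : level k x -> level l y -> k < j < l ->
  sep (a (zexpg h j) @` C2) x y.
Proof.
move=> lx ly /andP[kj jl] e; have := level_in2 ly jl.
by rewrite /in_translate -e => /(level_nin2 lx); apply.
Qed.

Lemma level_act k m x : level k x -> level (m + k) (a (zexpg h m) x).
Proof. by rewrite /level -addrA !in_translate_act. Qed.

(** The witness is a point of S2 outside h S1. *)
Lemma level0_exists : exists x, level 0 x.
Proof.
have [y p2 nh] := proper12; exists y; split.
  by rewrite in_translateP //= expg0 invg1 act1; exact: sub21.
rewrite add0r in_translateP //= expg1 => e; apply: (nh _ e); exact: actVK.
Qed.

(** The images under h^j and h^(j+1) of a vertex of level 0 are separated by the second translate
    but not by the first. *)
Lemma translates_nonparallel j :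
  ~ parallel (a (zexpg h j) @` C1) (a (zexpg h (j + 1)) @` C1).
Proof.
have cl k := clique_act a (zexpg h k) cC1.
have [x lx] := level0_exists.
have l1 := level_act j lx; have l2 := level_act (j + 1) lx.
rewrite !addr0 in l1 l2 => pj.
apply: (level_sep l1 l2 (j := j + 1)); first by lia.
apply: contrapT => /(sep_par pX ntX _ _ (cl j) (cl (j + 1)) pj); apply.
have := (level_in j l1).2 (lexx _); rewrite /in_translate => ->.
by apply/esym/(level_in j l2); lia.
Qed.

Lemma translates_cross j x y :
  adj x y -> sep (a (zexpg h j) @` C1) x y ->
  ~ sep (a (zexpg h (j + 1)) @` C1) x y.
Proof.
move=> xy s1 s2; have cl k := clique_act a (zexpg h k) cC1.
have [F [cF Fx Fy]] := edge_clique xy.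
apply: (@translates_nonparallel j); apply: (parallel_trans pX (cl _) cF (cl _)).
  apply: (parallelC cgX ntX cF (cl _)); exact: (sep_parallel cgX cF (cl _) Fx Fy).
exact: (sep_parallel cgX cF (cl _) Fx Fy).
Qed.

(** An edge cannot cross two consecutive translates, so the level changes by at most one along
    it. *)
Lemma level_adj k x y : adj x y -> level k x -> exists l, level l y.
Proof.
move=> xy lx.
have out j : k < j -> in_translate C1 c1 j y -> sep (a (zexpg h j) @` C1) x y.
  move=> kj iy e; move: iy; rewrite /in_translate -e => /(level_in j lx); lia.
have inn j : j <= k -> ~ in_translate C1 c1 j y -> sep (a (zexpg h j) @` C1) x y.
  by move=> jk ny e; apply: ny; rewrite /in_translate -e; apply/(level_in j lx).
have [i1|n1] := pselect (in_translate C1 c1 (k + 1) y).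
  exists (k + 1); split=> // i2.
  by apply: (translates_cross xy (out _ _ i1) (out _ _ i2)); lia.
have [i0|n0] := pselect (in_translate C1 c1 k y); first by exists k.
exists (k - 1); rewrite /level subrK; split=> //; apply: contrapT => nm1.
apply: (translates_cross xy (inn _ _ nm1)); first by lia.
by rewrite subrK; apply: inn.
Qed.

(** Nestedness alone does not keep a vertex from lying in all translates, or in none; levels are
    propagated along paths from a vertex of level 0. *)
Lemma level_exists x : exists k, level k x.
Proof.
have [y ly] := level0_exists; have [n [p [pp <- _]]] := conX y x.
move: (ly) pp; move: {1}0 => k; elim: p y k {ly} => [|z p IHp] y k ly /=; first by exists k.
by case/andP => /level_adj/(_ ly)[l lz] /(IHp _ _ lz).
Qed.

End Skewering.

(** * Contraction along the axis *)

Section Axis.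
Local Open Scope classical_set_scope.
Local Open Scope ring_scope.
Variables (G : groupType) (X : graph) (a : graph_action G X).
Variables (R : realType) (delta : set X -> X -> X -> R).
Hypothesis pX : paraclique X.
Hypothesis ntX : exists x y : X, x <> y.
Hypothesis mdelta : metric_system delta.
Hypothesis cdelta : coherent delta.
Hypothesis idelta : invariant_system a delta.
Variable gam : int -> X.
Hypothesis gam_dist : forall i j : int, (dist (gam i) (gam j))%:Z = `|i - j|.
Implicit Types (x y z : X) (i j k m : int).
Let cgX : clique_gated X := pX.1.
Let conX : connected_graph X := cgX.1.
Let d := ext_metric delta.
Let d_triangle x y z : d x z <= d x y + d y z := ext_metric_triangle pX ntX mdelta cdelta x y z.
Let d_sym x y : d x y = d y x := ext_metric_sym pX ntX mdelta cdelta x y.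

Lemma axis_between i j k : `|i - k| = `|i - j| + `|j - k| ->
  dist (gam i) (gam k) = (dist (gam i) (gam j) + dist (gam j) (gam k))%N.
Proof. by rewrite -!gam_dist -PoszD => -[]. Qed.

(** Invariance makes consecutive orbit points equidistant, and distances add up along the axis by
    [ext_metric_geodesic]. *)
Lemma ext_metric_axis g (t : int) : (forall i, a g (gam i) = gam (i + t)) ->
  forall m n : int,
    d (gam (m * t)) (gam (n * t)) = `|m - n|%:~R * d (gam 0) (gam t).
Proof.
move=> gt; have step m : d (gam (m * t)) (gam ((m + 1) * t)) = d (gam 0) (gam t).
  rewrite -[RHS](ext_metric_act pX ntX mdelta cdelta idelta (zexpg g m)).
  by rewrite !(act_translation gt) add0r mulrDl mul1r addrC.
have nat_steps (m : int) (k : nat) :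
    d (gam (m * t)) (gam ((m + k%:Z) * t)) = k%:R * d (gam 0) (gam t).
  elim: k => [|k IHk]; first by rewrite addr0 mul0r /d ext_metric_xx.
  rewrite /d -(@ext_metric_geodesic _ _ _ pX ntX mdelta cdelta _ (gam ((m + k%:Z) * t))).
    rewrite -/d IHk -addn1 PoszD addrA step natrD mulrDl mul1r //.
  apply: axis_between; rewrite -!mulrBl !normrM; nia.
move=> m n; wlog mn : m n / m <= n => [hw|].
  by case: (leP m n) => [|/ltW] /hw // e; rewrite d_sym distrC.
have -> : n = m + `|n - m|%N%:Z by lia.
rewrite nat_steps; congr (_ * _); rewrite pmulrn; congr (_%:~R); lia.
Qed.

Lemma orbit_map_axis g (t : int) : (forall i, a g (gam i) = gam (i + t)) ->
  forall k, orbit_map a g (gam 0) k = gam (k * t).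
Proof. by move=> gt k; rewrite /orbit_map (act_translation gt) add0r. Qed.

Lemma axis_qi_embedding g (t : int) : t != 0 ->
  (forall i, a g (gam i) = gam (i + t)) ->
  qi_embedding d (orbit_map a g (gam 0)).
Proof.
move=> t0 gt; set s := d (gam 0) (gam t).
have s0 : 0 < s.
  apply: (ext_metric_gt0 pX ntX mdelta cdelta) => e.
  by have := gam_dist 0 t; rewrite e (distxx conX); lia.
(* One constant above 1, [s] and [s^-1], so that no additive term is needed. *)
exists (1 + s + s^-1), 0; have i0 : 0 < s^-1 by rewrite invr_gt0.
split=> // [|m n]; first by lra.
rewrite !(orbit_map_axis gt) (ext_metric_axis gt) -/s subr0 addr0.
rewrite !(mulrC _ `|m - n|%:~R).
have nn : (0 : R) <= `|m - n|%:~R by rewrite ler0z.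
apply/andP; split; rewrite ler_wpM2l //; last by lra.
rewrite -[leRHS]invrK lef_pV2 ?posrE //; lra.
Qed.

(** * Nearest-point projections to the orbit *)

Section Contraction.
Variables (g : G) (t n : int) (C1 C2 : set X) (c1 c2 : X) (L : R).
Let h := zexpg g n.
Hypothesis t0 : t != 0.
Hypothesis gt : forall i, a g (gam i) = gam (i + t).
Hypotheses (cC1 : clique C1) (cC2 : clique C2).
Hypothesis sub21 : forall x, gate_proj C2 x = c2 -> gate_proj C1 x = c1.
Hypothesis sub12 : forall x, gate_proj C1 x = c1 -> gate_proj C2 (a h x) = c2.
Hypothesis proper12 : exists2 y, gate_proj C2 y = c2 &
  forall x, gate_proj C1 x = c1 -> a h x <> y.
Hypothesis L0 : 0 <= L.
Hypothesis bL : sep_bounded delta C1 C2 L.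
Let lev := level a h C1 c1.
Let levels := level_exists pX ntX cC1 cC2 sub21 sub12 proper12.
Let orb := range (orbit_map a g (gam 0)).
(** The orbit of [gam 0] under h = g^n, inside the larger orbit [orb]; [level_orbit] computes levels
    exactly along it. *)
Let ob m := gam (m * (n * t)).
Let s := d (gam 0) (gam (n * t)).

Let ht i : a h (gam i) = gam (i + n * t).
Proof. exact: act_translation. Qed.

Let ob_orb m : orb (ob m).
Proof. by exists (m * n) => //; rewrite (orbit_map_axis gt) /ob mulrA. Qed.

Let obE m m' : d (ob m) (ob m') = `|m - m'|%:~R * s.
Proof. exact: ext_metric_axis ht m m'. Qed.

Let s_ge0 : 0 <= s.
Proof. exact: ext_metric_ge0. Qed.

Let n_neq0 : n != 0.
Proof.
apply/eqP => n0; have [y q2 nh] := proper12.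
by apply: (nh y (sub21 q2)); rewrite /h n0 /= expg0 act1.
Qed.

Variable k0 : int.
Hypothesis lev0 : lev k0 (gam 0).

Lemma level_orbit m : lev (m + k0) (ob m).
Proof.
by have := level_act pX cC1 m lev0; rewrite (act_translation ht) add0r.
Qed.

Lemma ob_near m m' (N : nat) : `|m - m'| <= N%:Z -> d (ob m) (ob m') <= N%:R * s.
Proof.
by move=> le; rewrite obE ler_wpM2r // -[N%:R]/(N%:Z%:~R) ler_int.
Qed.

(** The translates of [C1], [C2] by h^(k+1) and h^(k-1) bracket the orbit point of level [k]. The
    margin 2 is what the strict bounds of [level_sep2] need: k+1 lies strictly between k and k+2. *)
Lemma orbit_thin kx ky k x y : lev kx x -> lev ky y ->
  kx + 2 <= k -> k + 2 <= ky ->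
  d (ob (k - k0)) x + d (ob (k - k0)) y <= d x y + 4 * L.
Proof.
move=> lx ly hx hy; pose m := k - k0; have km : k = m + k0 by rewrite subrK.
rewrite -/m; rewrite {}km in hx hy.
have lm := level_orbit m; have lq := level_orbit (m + 2); have lq' := level_orbit (m - 2).
have bd j : sep_bounded delta (a (zexpg h j) @` C1) (a (zexpg h j) @` C2) L.
  exact: sep_bounded_act.
apply: (ext_metric_thin pX ntX mdelta cdelta (bd (m + k0 + 1)) (bd (m + k0 - 1))
  (q := ob (m + 2)) (q' := ob (m - 2))).
- apply: axis_between; rewrite mulrDl mulrBl; lia.
- by apply: (level_sep pX cC1 cC2 sub21 sub12 lm lq); lia.
- by apply: (level_sep2 pX cC1 cC2 sub21 sub12 lm lq); lia.
- by apply: (level_sep pX cC1 cC2 sub21 sub12 lx ly); lia.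
- by apply: (level_sep2 pX cC1 cC2 sub21 sub12 lx ly); lia.
- by apply/sep_sym/(level_sep pX cC1 cC2 sub21 sub12 lq' lm); lia.
- by apply/sep_sym/(level_sep2 pX cC1 cC2 sub21 sub12 lq' lm); lia.
- by apply: (level_sep pX cC1 cC2 sub21 sub12 lx ly); lia.
- by apply: (level_sep2 pX cC1 cC2 sub21 sub12 lx ly); lia.
Qed.

(** On the axis [z] lies between some [ob q] and [ob (q + 1)], which are at distance [s]. A geodesic
    crosses each translate at most once, so the level of [z] lies between theirs. *)
Lemma orbit_near_translate z kz : orb z -> lev kz z -> d z (ob (kz - k0)) <= s.
Proof.
move=> [r _ zE] lz; rewrite (orbit_map_axis gt) in zE.
(* Division with [e] between 0 and [n]; for [n < 0] the non-negative remainder is shifted by one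
   period. *)
have [q [e re ee]] : exists q, exists2 e, r = q * n + e & `|n| = `|e| + `|n - e|.
  have := divz_eq r n; have := modz_ge0 r n_neq0; have := ltz_mod r n_neq0.
  move: (r %/ n)%Z (r %% n)%Z => u v vn v0 ->.
  have [n0|n0] := leP 0 n; first by exists u, v; lia.
  by exists (u - 1), (n + v); [ring|lia].
have btw : dist (ob q) (ob (q + 1)) = (dist (ob q) z + dist z (ob (q + 1)))%N.
  rewrite -zE; apply: axis_between; rewrite re.
  have -> : q * (n * t) - (q + 1) * (n * t) = - (n * t) by ring.
  have -> : q * (n * t) - (q * n + e) * t = - (e * t) by ring.
  have -> : (q * n + e) * t - (q + 1) * (n * t) = - ((n - e) * t) by ring.
  by rewrite !normrN !normrM ee mulrDl.
have cl j : clique (a (zexpg h j) @` C1) by exact: clique_act.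
have lq := level_orbit q; have lq1 := level_orbit (q + 1).
have lo : q + k0 <= kz.
  rewrite leNgt; apply/negP => hz.
  apply: (geodesic_sep pX ntX (cl (q + k0)) btw).
    by apply/sep_sym/(level_sep pX cC1 cC2 sub21 sub12 lz lq); lia.
  by apply: (level_sep pX cC1 cC2 sub21 sub12 lz lq1); lia.
have hi : kz <= q + 1 + k0.
  rewrite leNgt; apply/negP => hz.
  apply: (geodesic_sep pX ntX (cl kz) btw).
    by apply: (level_sep pX cC1 cC2 sub21 sub12 lq lz); lia.
  by apply/sep_sym/(level_sep pX cC1 cC2 sub21 sub12 lq1 lz); lia.
have := ext_metric_geodesic pX ntX mdelta cdelta btw.
rewrite -/d obE (_ : `|q - (q + 1)| = 1) ?mul1r; last by lia.
have p1 := ext_metric_ge0 pX ntX mdelta cdelta (ob q) z.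
have p2 := ext_metric_ge0 pX ntX mdelta cdelta z (ob (q + 1)).
have [->|->] : kz - k0 = q \/ kz - k0 = q + 1 by lia.
  by rewrite d_sym /d; lra.
by rewrite /d; lra.
Qed.

Lemma ob_near_level z kz m (N : nat) : orb z -> lev kz z ->
  `|kz - (m + k0)| <= N%:Z -> d z (ob m) <= N.+1%:R * s.
Proof.
move=> oz lz le; apply: le_trans (d_triangle _ (ob (kz - k0)) _) _.
have := orbit_near_translate oz lz.
have : d (ob (kz - k0)) (ob m) <= N%:R * s by apply: ob_near; lia.
by rewrite -natr1 mulrDl mul1r; lra.
Qed.

(** If the levels of [x] and [z] differ by at least 4, [orbit_thin] at the orbit point two levels
    from [x] toward [z], with minimality of [z], puts that point within [4 * L] of [z]. Otherwise a
    gap of at most 3 costs [4 * s]. *)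
Lemma nearest_near_level x kx z : lev kx x -> nearest d orb x z ->
  d z (ob (kx - k0)) <= 4 * L + 4 * s.
Proof.
move=> lx [oz zmin]; have [kz lz] := levels z.
have close m : d (ob m) z <= 4 * L -> `|m - (kx - k0)| <= 2%:Z ->
    d z (ob (kx - k0)) <= 4 * L + 4 * s.
  move=> dm mk; have := ob_near mk; have := d_triangle z (ob m) (ob (kx - k0)).
  by rewrite (d_sym z (ob m)); have := s_ge0; lra.
have [far|near] := leP (kx + 4) kz.
  apply: (close (kx + 2 - k0)); last by lia.
  have far' : kx + 2 + 2 <= kz by lia.
  have := orbit_thin lx lz (lexx _) far'; have := zmin _ (ob_orb (kx + 2 - k0)).
  by rewrite (d_sym x (ob _)); lra.
have [far|near'] := leP (kz + 4) kx.
  apply: (close (kx - 2 - k0)); last by lia.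
  have [f1 f2] : kz + 2 <= kx - 2 /\ kx - 2 + 2 <= kx by lia.
  have := orbit_thin lz lx f1 f2; have := zmin _ (ob_orb (kx - 2 - k0)).
  by rewrite (d_sym x (ob _)) (d_sym z x); lra.
have near3 : `|kz - (kx - k0 + k0)| <= 3%:Z by lia.
by have := ob_near_level oz lz near3; have := L0; lra.
Qed.

(** If [x] is at least 4 levels from the centre [p], the orbit point two levels from [p] toward [x]
    is at distance at least [r] from [p], hence within [4 * L] of [x] by [orbit_thin], and [z] is
    within [8 * L] of it. Otherwise [nearest_near_level] and a shift of at most 3 levels give
    [4 * L + 7 * s]. *)
Lemma ball_near_level p kp r x z : lev kp p ->
  (forall y, orb y -> r <= d p y) -> d p x < r -> nearest d orb x z ->
  d z (ob (kp - k0)) <= 8 * L + 7 * s.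
Proof.
move=> lp far xr nz; have [kx lx] := levels x; have [oz zmin] := nz.
have sp := s_ge0.
have close m : d (ob m) x <= 4 * L -> `|m - (kp - k0)| <= 2%:Z ->
    d z (ob (kp - k0)) <= 8 * L + 7 * s.
  move=> dm mk; have := ob_near mk; have := d_triangle z (ob m) (ob (kp - k0)).
  have := d_triangle z x (ob m); have := zmin _ (ob_orb m).
  by rewrite (d_sym z x) (d_sym x (ob m)); lra.
have [far1|near1] := leP (kp + 4) kx.
  apply: (close (kp + 2 - k0)); last by lia.
  have far' : kp + 2 + 2 <= kx by lia.
  have := orbit_thin lp lx (lexx _) far'; have := far _ (ob_orb (kp + 2 - k0)).
  by rewrite (d_sym p (ob _)); lra.
have [far1|near2] := leP (kx + 4) kp.
  apply: (close (kp - 2 - k0)); last by lia.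
  have [f1 f2] : kx + 2 <= kp - 2 /\ kp - 2 + 2 <= kp by lia.
  have := orbit_thin lx lp f1 f2; have := far _ (ob_orb (kp - 2 - k0)).
  by rewrite (d_sym x p) (d_sym p (ob _)); lra.
have near3 : `|kx - k0 - (kp - k0)| <= 3%:Z by lia.
have := nearest_near_level lx nz; have := ob_near near3.
by have := d_triangle z (ob (kx - k0)) (ob (kp - k0)); have := L0; lra.
Qed.

Lemma skewering_contracting : contracting d a g.
Proof.
exists (gam 0); split; first exact: axis_qi_embedding t0 gt.
exists (2 * (8 * L + 7 * s)); first by have := s_ge0; have := L0; lra.
move=> p r empty x y z w xr yr nz nw; have [kp lp] := levels p.
have far o : orb o -> r <= d p o.
  move=> oo; rewrite leNgt; apply/negP => lt.
  by have : set0 o by rewrite -empty.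
have := ball_near_level lp far xr nz; have := ball_near_level lp far yr nw.
have := d_triangle z (ob (kp - k0)) w; rewrite (d_sym (ob _) w); lra.
Qed.

End Contraction.
End Axis.

Theorem theorem4p3 (R : realType) (G : groupType) (X : graph)
  (a : graph_action G X) (delta : set X -> X -> X -> R) (g : G)
  (hX : paraclique X)
  (hmetric : metric_system delta)
  (hcoh : coherent delta)
  (hinv : invariant_system a delta)
  (haxis : admits_axis a g)
  (hskew : exists J1 J2 : set (X * X),
     [/\ hyperplane J1, hyperplane J2, skewers a g J1 J2
       & well_separated delta J1 J2]) :
  contracting (ext_metric delta) a g.
Proof.
have [gam [gam_dist [t t0 gt]]] := haxis.
(* Two axis points at distance 1 exclude the one-vertex graph, whose clique is a singleton. *)
have ntX : exists x y : X, x <> y.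
  exists (gam 0%R), (gam 1%R) => e; have := gam_dist 0%R 1%R.
  by rewrite e (distxx hX.1.1).
have [J1 [J2 [[C1 cC1 J1E] [C2 cC2 J2E] skew]]] := hskew.
rewrite {}J1E {}J2E -/(hyp_of C1) -/(hyp_of C2) in skew * => ws.
have [L L0 bL] := well_separated_sep_bounded hX ntX hcoh cC1 cC2 ws.
have [S1 [S2 [sS1 sS2 [S21 _] [n [S12 nS]]]]] := skew.
have [c1 Cc1 S1E] := (sectorE hX ntX _ cC1).1 sS1.
have [c2 Cc2 S2E] := (sectorE hX ntX _ cC2).1 sS2.
rewrite {}S1E {}S2E in S21 S12 nS.
have sub12 x : gate_proj C1 x = c1 -> gate_proj C2 (a (zexpg g n) x) = c2.
  by move=> xc; apply: S12; exists x.
have proper12 : exists2 y, gate_proj C2 y = c2 &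
    forall x, gate_proj C1 x = c1 -> a (zexpg g n) x <> y.
  apply: contrapT => none; apply: nS => y /= yc; apply: contrapT => ny.
  by apply: none; exists y => // x xc e; apply: ny; exists x.
have [k0 lev0] := level_exists hX ntX cC1 cC2 S21 sub12 proper12 (gam 0%R).
exact: (skewering_contracting hX ntX hmetric hcoh hinv gam_dist t0 gt cC1 cC2
  S21 sub12 proper12 L0 bL lev0).
Qed.
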